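(* Let $N\ge 2$ be an integer, $x_0\in\mathbb{R}^N$, $r>0$, $c>0$, $\alpha\in(0,1)$, $\gamma''>0$, and $\delta,\lambda\in(0,1)$. Then there exists $\eta\in(0,1)$, independent of $u$ (i.e. determined by the data just listed), such that the following holds. For every $u\in BV(Q_r(x_0))$ satisfying (a) $\big|\{x\in Q_r(x_0):\,u(x)>c\}\big| > \alpha r^N$, and (b$''$) $[u]_{BV(Q_r(x_0))} \le \gamma''\, c\, r^{N-1}$, there exists a point $x_1\in Q_r(x_0)$ such that $$\big|\{x\in Q_{\eta r}(x_1):\,u(x)>\lambda c\}\big| > (1-\delta)(\eta r)^N.$$
   Context: For $x\in\mathbb{R}^N$ and $r>0$, $Q_r(x)=\prod_{i=1}^N\big(x^i-\frac r2,\,x^i+\frac r2\big)$ is the open cube centered at $x$ with side $r$. $|A|$ denotes the $N$-dimensional Lebesgue measure of $A\subset\mathbb{R}^N$. For an open set $\Omega\subset\mathbb{R}^N$, $u\in BV(\Omega)$ means that $u\in L^1(\Omega)$ (real-valued) and the quantity $$[u]_{BV(\Omega)}=\sup\Big\{\int_\Omega u\,\mathrm{div}\,\phi\,dx:\ \phi\in C^\infty_c(\Omega,\mathbb{R}^N),\ |\phi(x)|\le 1\ \text{for all } x\in\Omega\Big\}$$ is finite. Since $u$ is defined only on $Q_r(x_0)$, the set $\{x\in Q_{\eta r}(x_1):\,u(x)>\lambda c\}$ is understood as a subset of $Q_{\eta r}(x_1)\cap Q_r(x_0)$. *)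

(* Defs.v *)
From HB Require Import structures.
From mathcomp Require Import all_boot all_order all_algebra.
From mathcomp Require Import all_classical all_reals all_analysis.

Set Implicit Arguments.
Unset Strict Implicit.
Unset Printing Implicit Defensive.
Import Order.TTheory GRing.Theory Num.Theory.
Import numFieldNormedType.Exports.

Local Open Scope classical_set_scope.
Local Open Scope ring_scope.

Section lebesgue_outer_measure.
Context {R : realType} {N : nat}.
Implicit Types (a b x : 'rV[R]_N) (A : set 'rV[R]_N).

Definition open_box a b : set 'rV[R]_N :=
  [set x | forall i, a 0 i < x 0 i < b 0 i].

(* A box with b 0 i <= a 0 i for some i is empty, and gets volume 0. *)
Definition box_volume a b : R := \prod_(i < N) Num.max 0 (b 0 i - a 0 i).

Lemma box_volume_ge0 a b : 0 <= box_volume a b.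
Proof. by apply: prodr_ge0 => i _; rewrite le_max lexx. Qed.

Definition box_cover A (C : set ('rV[R]_N * 'rV[R]_N)) :=
  countable C /\ A `<=` \bigcup_(p in C) open_box p.1 p.2.

Local Open Scope ereal_scope.

Definition cover_volume (C : set ('rV[R]_N * 'rV[R]_N)) : \bar R :=
  \esum_(p in C) (box_volume p.1 p.2)%:E.

Lemma cover_volume_ge0 C : 0 <= cover_volume C.
Proof. by apply: esum_ge0 => p _; rewrite lee_fin box_volume_ge0. Qed.

(* The infimum runs over countable sets of boxes rather than sequences of boxes
   so that the empty set has the empty cover: in dimension 0 every box has
   volume 1. *)
Definition lebesgue_outer A : \bar R :=
  ereal_inf [set cover_volume C | C in box_cover A].

Let lebesgue_outer_ge0 A : 0 <= lebesgue_outer A.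
Proof. by apply: le_ereal_inf_tmp => _ [C _ <-]; exact: cover_volume_ge0. Qed.

Let lebesgue_outer0 : lebesgue_outer set0 = 0.
Proof.
apply/eqP; rewrite eq_le lebesgue_outer_ge0 andbT.
apply: ereal_inf_lbound; exists set0; last by rewrite /cover_volume esum_set0.
by split; [exact: countable0|exact: sub0set].
Qed.

Let le_lebesgue_outer :
  {homo lebesgue_outer : A B / A `<=` B >-> A <= B}.
Proof.
move=> A B AB; apply: ereal_inf_le_tmp => _ [C [cC BC] <-].
by exists C => //; split => //; exact: subset_trans BC.
Qed.

Let lebesgue_outer_sigma_subadditive : sigma_subadditive lebesgue_outer.
Proof.
move=> F; have [[i ioo]|] := pselect (exists i, lebesgue_outer (F i) = +oo).
  rewrite (eseries_pinfty _ _ ioo) ?leey// => n _.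
  by rewrite -ltNye (lt_le_trans _ (lebesgue_outer_ge0 _)).
rewrite -forallNE => Foo; apply/lee_addgt0Pr => e e0.
apply: (le_trans _ (epsilon_trick xpredT
  (fun n => lebesgue_outer_ge0 (F n)) (ltW e0))).
have [C PC] : {C : nat -> set ('rV[R]_N * 'rV[R]_N) & forall n,
    box_cover (F n) (C n) /\
    cover_volume (C n) <= lebesgue_outer (F n) + (e / (2 ^ n.+1)%:R)%:E}.
  apply: (@choice _ _ (fun n C => box_cover (F n) C /\
    cover_volume C <= lebesgue_outer (F n) + (e / (2 ^ n.+1)%:R)%:E)) => n.
  have en : (0 < e / (2 ^ n.+1)%:R)%R by rewrite divr_gt0// ltr0n expn_gt0.
  have Fn : lebesgue_outer (F n) \is a fin_num.
    by rewrite ge0_fin_numE// ltey; apply/eqP; exact: Foo.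
  have [_ [C FC <-] /ltW vC] := lb_ereal_inf_adherent en Fn.
  by exists C.
have vol0 (p : 'rV[R]_N * 'rV[R]_N) : 0 <= (box_volume p.1 p.2)%:E.
  by rewrite lee_fin box_volume_ge0.
apply: (@le_trans _ _ (cover_volume (\bigcup_n C n))).
  apply: ereal_inf_lbound; exists (\bigcup_n C n) => //; split.
    by apply: bigcup_countable => // n _; exact: (PC n).1.1.
  move=> x [n _ /(PC n).1.2[p Cp px]].
  by exists p => //; exists n.
rewrite /cover_volume seqDU_bigcup_eq nneseries_sum_bigcup//.
apply: lee_nneseries => [n _ _|n _]; first by apply: esum_ge0 => p _.
apply: le_trans (PC n).2; rewrite /cover_volume.
by apply: le_ereal_sup => _ [X [finX XC] <-]; exists X => //; split => //;
  apply: subset_trans XC _; exact: subset_seqDU.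
Qed.

HB.instance Definition _ := isOuterMeasure.Build R 'rV[R]_N lebesgue_outer
  lebesgue_outer0 lebesgue_outer_ge0 le_lebesgue_outer
  lebesgue_outer_sigma_subadditive.

End lebesgue_outer_measure.

Section lebesgue_measure_rV.
Context {R : realType} (N : nat).

Definition lebesgue_space := caratheodory_type (@lebesgue_outer R N).

HB.instance Definition _ := Measurable.copy lebesgue_space
  (caratheodory_type (@lebesgue_outer R N : {outer_measure set _ -> \bar R})).

(* The sigma-algebra of lebesgue_space consists of all Lebesgue measurable,
   that is, Caratheodory measurable, subsets of R^N. *)
Definition lebesgue_rV : set lebesgue_space -> \bar R := @lebesgue_outer R N.

HB.instance Definition _ := isMeasure.Build _ _ _ lebesgue_rV
  (caratheodory_measure0 (@lebesgue_outer R N))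
  (caratheodory_measure_ge0 (mu := @lebesgue_outer R N))
  (caratheodory_measure_sigma_additive (mu := @lebesgue_outer R N)).

End lebesgue_measure_rV.
Arguments lebesgue_space R N : clear implicits.
Arguments lebesgue_rV {R} N _.

Section BV_space.
Context {R : realType} {N : nat}.
Implicit Types (f u : 'rV[R]_N -> R) (phi : 'rV[R]_N -> 'rV[R]_N)
  (Omega : set 'rV[R]_N).

Definition cube (x : 'rV[R]_N) (r : R) : set 'rV[R]_N :=
  open_box (x - const_mx (r / 2)) (x + const_mx (r / 2)).

Definition partial (i : 'I_N) f : 'rV[R]_N -> R := 'D_(delta_mx 0 i) f.

Definition iter_partial (s : seq 'I_N) f : 'rV[R]_N -> R := foldr partial f s.

Definition smooth f := forall s : seq 'I_N,
  continuous (iter_partial s f) /\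
  forall (i : 'I_N) x, derivable (iter_partial s f) x (delta_mx 0 i).

Definition divergence phi (x : 'rV[R]_N) : R :=
  \sum_(i < N) partial i (fun y => phi y 0 i) x.

(* The norm of the library on 'rV[R]_N is the sup norm. *)
Definition euclidean_norm (v : 'rV[R]_N) : R :=
  Num.sqrt (\sum_(i < N) v 0 i ^+ 2).

(* Compactly supported fields on Omega are represented by their extension by
   zero to the whole space. *)
Definition test_field Omega : set ('rV[R]_N -> 'rV[R]_N) :=
  [set phi : 'rV[R]_N -> 'rV[R]_N | [/\ forall i, smooth (fun x => phi x 0 i),
    compact (closure [set x | phi x != 0]),
    closure [set x | phi x != 0] `<=` Omega &
    forall x, Omega x -> euclidean_norm (phi x) <= 1]].

Definition BV_seminorm Omega u : \bar R :=
  ereal_sup [set (\int[lebesgue_rV N]_(x in Omega) (u x * divergence phi x)%:E)%E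
            | phi in test_field Omega].

(* Only the values of u on Omega matter. *)
Definition BV Omega u :=
  (lebesgue_rV N).-integrable Omega (EFin \o u) /\ (BV_seminorm Omega u < +oo)%E.

End BV_space.

(* Main.v *)
(* Cut the cube into n^N blocks of side r/n and suppose that in every block the
   set [u <= lambda c] has density at least [delta]. For x in the set [u > c],
   which has measure at least alpha r^N, and y in the set [u <= lambda c] of the
   block of x, one has u x - u y >= (1 - lambda) c, so the sum over the blocks of
   the double integral of |u x - u y| is at least
   alpha delta (1 - lambda) c r^N (r/n)^N.
   On the other hand this sum is at most a constant times (r/n)^(N+1) [u]_BV, a
   Poincare inequality on the blocks. For n large this contradicts (b'').

   The Poincare inequality is proved by duality. Each block is cut into m^N cells
   of side h carrying translates b_K of a smooth product bump. Given signs sg_w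
   for the pairs w = (K, K') of cells of one block, moving the coordinates of K
   to those of K' one after the other exhibits sum_w sg_w (b_K - b_K') as h
   times the divergence of an explicit smooth field of size m^(N+1). This bounds
   sum_w |int u b_K - int u b_K'| by h N m^(N+1) [u]_BV, and for m large u is
   L^1-close to a function constant on the cells, for which the left-hand side
   is comparable to the double integral above. *)
Require Import Defs.
From mathcomp Require Import all_boot all_order all_algebra.
From mathcomp Require Import all_classical all_reals all_analysis.
From mathcomp Require Import measurable_realfun lra ring.
Import Order.TTheory GRing.Theory Num.Theory.
Import numFieldNormedType.Exports HBSimple.
Set Implicit Arguments.
Unset Strict Implicit.
Unset Printing Implicit Defensive.
Local Open Scope classical_set_scope.
Local Open Scope ring_scope.

(** * Lebesgue measure of boxes *)

(** The order of the choices is the obstacle. [eta = 1/n] is fixed before [u], whereas the mesh on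
    which [u] is nearly constant depends on [u]; hence the Poincare estimate must not deteriorate as
    m grows. It does not, because a single field serves all pairs. In dimension d, at a given point,
    the coordinate being moved sees the m^2 interval pairs of one block, and every other coordinate
    sees one interval with its m partners: the field is at most m^(d+1), whatever n is. The squared
    cell volume h^(2d), divided by the mass of a bump, of order h^d, leaves h^d * h * m^(d+1) = (h
    m)^(d+1), where the mesh enters only through the block side h m = r/n. Bumps stand in for
    indicators of cells because the seminorm tests smooth fields only; a bump keeps a fixed fraction
    of the volume of its cell, so that only constants are lost. Where measures are involved the
    dimension is written [N.+1]. *)

Section box_measure.
Context {R : realType} {N : nat}.
Implicit Types (a b x : 'rV[R]_N.+1) (A : set 'rV[R]_N.+1).
Local Notation mu := (@lebesgue_outer R N.+1).

Lemma lebesgue_outer_box_le A a b :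
  A `<=` open_box a b -> (mu A <= (box_volume a b)%:E)%E.
Proof.
move=> Aab; apply: ereal_inf_lbound; exists [set (a, b)].
  by split; [exact: countable1|move=> x /Aab; exists (a, b)].
by rewrite /cover_volume esum_set1// lee_fin box_volume_ge0.
Qed.

(** Positive dimension matters here, since the empty product is 1. Degenerate boxes can thus pad
    enumerations of covers at no cost. *)
Lemma box_volume_id a : box_volume a a = 0.
Proof. by rewrite /box_volume big_ord_recl subrr maxxx mul0r. Qed.

Lemma box_volume_incl a b : (forall i, a 0 i <= b 0 i) ->
  box_volume a b = \prod_(i < N.+1) (b 0 i - a 0 i).
Proof. by move=> ab; apply: eq_bigr => i _; apply/max_idPr; rewrite subr_ge0. Qed.

(** Passes from countable sets of boxes to sequences, whose series can be compared term by term. [g]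
    inverts an injection of the set into [nat]; an index outside the image gets the degenerate box
    [(0, 0)]. *)
Lemma lebesgue_outer_seq_cover A (v : \bar R) : (mu A < v)%E ->
  exists p q : nat -> 'rV[R]_N.+1,
    A `<=` \bigcup_k open_box (p k) (q k) /\
    (\sum_(0 <= k <oo) (box_volume (p k) (q k))%:E < v)%E.
Proof.
move=> /ereal_inf_lt[_ [C [/countable_injP[f finj] AC] <-] Cv].
pose g k := xget (0, 0) (C `&` f @^-1` [set k]).
have gf c : C c -> g (f c) = c.
  move=> Cc; rewrite /g; case: xgetP => [_ -> [Cd /= fd]|/(_ c)]; last by case.
  by apply: finj => //; rewrite inE.
exists (fst \o g), (snd \o g); split.
  by move=> x /AC[c Cc cx]; exists (f c) => //=; rewrite gf.
apply: le_lt_trans Cv; rewrite nneseries_esumT => [|k]; last first.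
  by rewrite lee_fin box_volume_ge0.
rewrite /cover_volume.
rewrite [leRHS](_ : _ = \esum_(k in f @` C) (box_volume (g k).1 (g k).2)%:E)%E.
  rewrite [leRHS]esum_mkcond; apply: le_esum => k _.
  case: ifPn => // /negP; rewrite inE => Ck.
  rewrite /g /=; case: xgetP => [_ -> [Cd /= fd]|_ /=].
    by exfalso; apply: Ck; exists (xget (0, 0) (C `&` f @^-1` [set k])).
  by rewrite box_volume_id.
rewrite esum_image; last by move=> c d; exact: finj.
by apply: eq_esum => c Cc /=; rewrite gf.
Qed.

Lemma lebesgue_outer_le_series A (p q : nat -> 'rV[R]_N.+1) :
  A `<=` \bigcup_k open_box (p k) (q k) ->
  (mu A <= \sum_(0 <= k <oo) (box_volume (p k) (q k))%:E)%E.
Proof.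
move=> Apq; apply: le_trans (le_outer_measure _ _ _ Apq) _.
apply: le_trans (outer_measure_sigma_subadditive _ _) _.
by apply: lee_nneseries => k _ //; exact: lebesgue_outer_box_le.
Qed.

End box_measure.

(** * Hyperplanes and measurability of half-spaces *)

Section halfspaces.
Context {R : realType} {N : nat}.
Implicit Types (a b x z : 'rV[R]_N.+1) (A : set 'rV[R]_N.+1) (i : 'I_N.+1).
Local Notation mu := (@lebesgue_outer R N.+1).

Definition set_coord a i (t : R) : 'rV[R]_N.+1 :=
  \row_j if j == i then t else a 0 j.

Lemma box_volumeD1 a b i : box_volume a b =
  Num.max 0 (b 0 i - a 0 i) * \prod_(j < N.+1 | j != i) Num.max 0 (b 0 j - a 0 j).
Proof. by rewrite /box_volume (bigD1 i). Qed.

Lemma box_volume_set_coord a b i s t :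
  box_volume (set_coord a i s) (set_coord b i t) =
  Num.max 0 (t - s) * \prod_(j < N.+1 | j != i) Num.max 0 (b 0 j - a 0 j).
Proof.
rewrite (box_volumeD1 _ _ i) !mxE eqxx; congr *%R; apply: eq_bigr => j ji.
by rewrite !mxE (negPf ji).
Qed.

Lemma set_coord_id a i : set_coord a i (a 0 i) = a.
Proof. by apply/rowP => j; rewrite !mxE; case: eqP => // ->. Qed.

(** The cut by the hyperplane where coordinate [i] equals [t]. The [min] and [max] also allow a
    hyperplane that misses the box: one piece is then degenerate and has volume 0. *)
Lemma box_volume_split a b i t :
  box_volume a (set_coord b i (Num.min (b 0 i) t)) +
  box_volume (set_coord a i (Num.max (a 0 i) t)) b = box_volume a b.
Proof.
rewrite -{1}[a](set_coord_id _ i) -{3}[b](set_coord_id _ i).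
rewrite !box_volume_set_coord (box_volumeD1 a b i) -mulrDl; congr *%R.
case: (leP (b 0 i) t) => ?; case: (leP (a 0 i) t) => ?;
  rewrite /Num.max; repeat (case: ifPn; rewrite -?leNgt => ?); lra.
Qed.

Lemma lebesgue_outer_slab A i z t e K : 0 <= e -> 0 <= K ->
  (forall x, A x -> `|x 0 i - t| < e /\ forall j, `|x 0 j - z 0 j| < K) ->
  (mu A <= (2 * e * (2 * K) ^+ N)%:E)%E.
Proof.
move=> e0 K0 Atz.
apply: (le_trans (@lebesgue_outer_box_le _ _ _
  (set_coord (z - const_mx K) i (t - e)) (set_coord (z + const_mx K) i (t + e)) _)).
  move=> x /Atz[xt xz] j; rewrite !mxE; case: eqP => [->|_].
    by move: xt; rewrite ltr_distl.
  by have := xz j; rewrite ltr_distl.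
rewrite lee_fin box_volume_set_coord.
rewrite (_ : t + e - (t - e) = 2 * e); last by ring.
rewrite (max_idPr _) ?mulr_ge0//.
rewrite (eq_bigr (fun=> 2 * K)) => [|j _]; last first.
  rewrite !mxE (_ : _ - _ = 2 * K); last by ring.
  by rewrite (max_idPr _) ?mulr_ge0.
by rewrite prodr_const cardC1 card_ord.
Qed.

(** The bounded pieces [H k] exhaust the hyperplane, and each lies in slabs of arbitrarily small
    volume. *)
Lemma lebesgue_outer_hyperplane i t : mu [set x | x 0 i = t] = 0.
Proof.
apply/eqP; rewrite eq_le outer_measure_ge0 andbT.
pose H k := [set x : 'rV[R]_N.+1 | x 0 i = t /\ forall j, `|x 0 j| < k%:R].
have H0 k : mu (H k) = 0.
  apply/eqP; rewrite eq_le outer_measure_ge0 andbT.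
  apply/lee_addgt0Pr => e e0; rewrite add0e.
  have C0 : 0 < 2 * (2 * k%:R) ^+ N + 1 :> R.
    by rewrite ltr_pwDr// mulr_ge0// exprn_ge0// mulr_ge0.
  apply: le_trans (@lebesgue_outer_slab _ i 0 t
    (e / (2 * (2 * k%:R) ^+ N + 1)) k%:R _ _ _) _ => //.
  - by rewrite divr_ge0// ltW.
  - by move=> x [-> xk]; rewrite subrr normr0 divr_gt0//; split=> // j;
      rewrite mxE subr0.
  - move: C0; set D := (2 * k%:R) ^+ N => C0.
    rewrite lee_fin (_ : _ * _ * D = e * (2 * D) / (2 * D + 1)); last by ring.
    by rewrite ler_pdivrMr// mulrDr lerDl mulr1 ltW.
apply: (@le_trans _ _ (mu (\bigcup_k H k))).
  apply: le_outer_measure => x /= xt.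
  pose k := Num.truncn (\sum_j `|x 0 j|); exists k.+1 => //; split=> // j.
  apply: le_lt_trans (truncnS_gt _).
  rewrite (bigD1 j)//= lerDl; exact: sumr_ge0.
apply: le_trans (outer_measure_sigma_subadditive _ _) _.
by rewrite eseries0// => k _ _; exact: H0.
Qed.

(** Cutting every box of a nearly optimal cover of the test set gives covers of its two sides with
    the same total volume. The cut boxes are open and miss the hyperplane, which is therefore split
    off first as a null set. *)
Lemma caratheodory_halfspace i t : mu.-caratheodory [set x | x 0 i < t].
Proof.
apply: le_caratheodory_measurable => X.
apply/lee_addgt0Pr => e e0.
change (mu (X `&` [set x | (x 0 i < t)%R]) +
  mu (X `&` ~` [set x | (x 0 i < t)%R]) <= mu X + e%:E)%E.
have [->|muX] := eqVneq (mu X) +oo%E; first by rewrite addye// leey.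
have Xfin : mu X \is a fin_num by rewrite ge0_fin_numE ?outer_measure_ge0// ltey.
have /lebesgue_outer_seq_cover[p [q [Xpq /ltW pqX]]] : (mu X < mu X + e%:E)%E.
  by rewrite lteDl// lte_fin.
apply: le_trans pqX.
have -> : X `&` ~` [set x | x 0 i < t] =
    (X `&` [set x | t < x 0 i]) `|` (X `&` [set x | x 0 i = t]).
  apply/seteqP; split=> x /=.
    by move=> [Xx /negP]; rewrite -leNgt le_eqVlt => /predU1P[->|]; [right|left].
  by move=> [|] [Xx xt]; split=> //; apply/negP; rewrite -leNgt ?xt// ltW.
apply: (@le_trans _ _ (mu (X `&` [set x | (x 0 i < t)%R])
    + mu (X `&` [set x | (t < x 0 i)%R]))%E).
  apply: leeD => //; apply: le_trans (outer_measureU2 _ _ _) _.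
  rewrite -[leRHS]adde0; apply: leeD => //.
  by rewrite -(lebesgue_outer_hyperplane i t); apply: le_outer_measure => x [].
have Xlt : X `&` [set x | x 0 i < t] `<=` \bigcup_k
    open_box (p k) (set_coord (q k) i (Num.min (q k 0 i) t)).
  move=> x [/Xpq[k _ xk] /= xt]; exists k => // j; rewrite !mxE.
  by case: eqP => [->|_]; rewrite ?lt_min ?xt ?andbT; exact: xk.
have Xgt : X `&` [set x | t < x 0 i] `<=` \bigcup_k
    open_box (set_coord (p k) i (Num.max (p k 0 i) t)) (q k).
  move=> x [/Xpq[k _ xk] /= xt]; exists k => // j; rewrite !mxE.
  by case: eqP => [->|_]; rewrite ?gt_max ?xt ?andbT; exact: xk.
apply: le_trans (leeD (lebesgue_outer_le_series Xlt) (lebesgue_outer_le_series Xgt)) _.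
rewrite -nneseriesD; do ?by move=> *; rewrite lee_fin box_volume_ge0.
apply: lee_nneseries => k *; first by rewrite adde_ge0// lee_fin box_volume_ge0.
by rewrite -EFinD lee_fin box_volume_split.
Qed.

End halfspaces.

(** * Lower bound for the measure of a box *)

Section box_lower_bound.
Context {R : realType}.

(* Fubini for indicators of boxes, one coordinate at a time: this replaces
   the usual compactness argument. *)
Lemma weighted_cover_volume n (a b : nat -> R) (p q : nat -> nat -> R)
    (c : nat -> R) : (forall k, 0 <= c k) ->
  (forall x : nat -> R, (forall i, (i < n)%N -> a i < x i < b i) ->
    (1 <= \sum_(0 <= k <oo)
      (c k * \prod_(i < n) \1_(`]p k i, q k i[%classic) (x i))%:E)%E) ->
  ((\prod_(i < n) Num.max 0 (b i - a i))%:E <=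
    \sum_(0 <= k <oo) (c k * \prod_(i < n) Num.max 0 (q k i - p k i))%:E)%E.
Proof.
elim: n c => [|n IHn] c c0 cov.
  rewrite big_ord0; apply: le_trans (cov (fun=> 0) _) _ => //.
  by apply: lee_nneseries => k _ *; rewrite !big_ord0// mulr1 lee_fin.
pose V k := \prod_(i < n) Num.max 0 (q k i - p k i).
have V0 k : 0 <= V k by apply: prodr_ge0 => i _; rewrite le_max lexx.
(* For a fixed last coordinate [t], its indicators are absorbed into the weights, which is why [c]
   is arbitrary. Integrating over [t] afterwards restores the missing factor on both sides. *)
have step t : a n < t < b n ->
  ((\prod_(i < n) Num.max 0 (b i - a i))%:E <=
    \sum_(0 <= k <oo) (c k * V k * \1_(`]p k n, q k n[%classic) t)%:E)%E.
  move=> tn; under eq_eseriesr do rewrite mulrAC.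
  apply: IHn => [k|x xab]; first by rewrite mulr_ge0// indicE.
  pose y i := if i == n then t else x i.
  have := cov y; rewrite /y => {}cov.
  apply: le_trans (cov _) _.
    move=> i; rewrite ltnS leq_eqVlt; case: eqP => [->|_] //=; exact: xab.
  apply: lee_nneseries => [k _ _|k _].
    by rewrite lee_fin mulr_ge0// prodr_ge0// => i _; rewrite indicE.
  rewrite big_ord_recr/= eqxx lee_fin mulrA mulrAC.
  rewrite (eq_bigr (fun i : 'I_n => \1_(`]p k i, q k i[%classic) (x i)))//.
  by move=> i _; rewrite (ltn_eqF (ltn_ord i)).
rewrite big_ord_recr /=.
under eq_eseriesr do rewrite big_ord_recr /= mulrA -/(V _).
set W := \prod_(i < n) _ in step *.
have W0 : 0 <= W by apply: prodr_ge0 => i _; rewrite le_max lexx.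
have itv (s t : R) : (lebesgue_measure `]s, t[%classic = (Num.max 0 (t - s))%:E)%E.
  rewrite lebesgue_measure_itv/= lte_fin /Num.max subr_gt0.
  by case: ifPn => //.
have -> : ((W * Num.max 0 (b n - a n))%:E =
    \int[lebesgue_measure]_(x in `]a n, b n[) (cst W%:E) x)%E.
  by rewrite integral_cst//= itv EFinM.
pose F k (x : R) : \bar R := (c k * V k * \1_(`]p k n, q k n[%classic) x)%:E.
have F0 k x : (0 <= F k x)%E by rewrite lee_fin !mulr_ge0// indicE.
have mF k : measurable_fun setT (F k).
  by apply/measurable_EFinP; apply: measurable_funM => //; exact: measurable_indic.
have mI k : measurable_fun setT (fun x : R => (\1_(`]p k n, q k n[%classic) x : R)%:E).
  by apply/measurable_EFinP; exact: measurable_indic.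
pose G x := (\sum_(0 <= k <oo) F k x)%E.
have mG D : measurable_fun D G.
  by apply: measurable_funTS; apply: ge0_emeasurable_sum => // k x _ _; exact: F0.
apply: (@le_trans _ _ (\int[lebesgue_measure]_(x in setT) G x)%E).
  apply: (@le_trans _ _ (\int[lebesgue_measure]_(x in `]a n, b n[) G x)%E).
    apply: ge0_le_integral => //; exact: mG.
  apply: ge0_subset_integral => //; first exact: mG.
  move=> x _.
  by apply: nneseries_ge0 => k _ _; exact: F0.
rewrite integral_nneseries//.
apply: lee_nneseries => [k _ _|k _].
  by apply: integral_ge0 => x _; rewrite lee_fin !mulr_ge0// indicE.
under eq_integral do rewrite /F EFinM.
rewrite ge0_integralZl_EFin ?mulr_ge0//.
- by rewrite integral_indic// setIT [leRHS]EFinM -itv.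
- exact: mI.
Qed.

End box_lower_bound.

Section lebesgue_rV_theory.
Context {R : realType} {N : nat}.
Implicit Types (a b x z : 'rV[R]_N.+1) (A : set 'rV[R]_N.+1) (i : 'I_N.+1).
Local Notation T := (lebesgue_space R N.+1).
Local Notation mu := (@lebesgue_rV R N.+1).

(** On the box, the indicators of the boxes of any cover sum to at least 1, so
    [weighted_cover_volume] applies with unit weights. [f] indexes the coordinates by [nat], as the
    induction on the dimension requires. *)
Lemma box_volume_le_lebesgue a b : ((box_volume a b)%:E <= mu (open_box a b))%E.
Proof.
apply/lee_addgt0Pr => e e0.
have [->|muX] := eqVneq (mu (open_box a b)) +oo%E; first by rewrite addye// leey.
have /lebesgue_outer_seq_cover[p [q [abpq /ltW pqX]]] :
    (mu (open_box a b) < mu (open_box a b) + e%:E)%E.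
  rewrite lteDl ?lte_fin//; apply: fin_real; rewrite ltey muX andbT.
  by rewrite (lt_le_trans _ (measure_ge0 mu _)).
apply: le_trans pqX.
pose f (v : 'rV[R]_N.+1) (k : nat) := v 0 (inord k).
have := @weighted_cover_volume R N.+1 (f a) (f b) (fun k => f (p k))
  (fun k => f (q k)) (fun=> 1) (fun=> ler01).
under eq_bigr do rewrite /f inord_val.
under eq_eseriesr do [rewrite mul1r; under eq_bigr do rewrite /f inord_val].
apply=> x xab.
pose y := \row_(i < N.+1) x i : 'rV[R]_N.+1.
have /abpq[k _ yk] : open_box a b y.
  by move=> i; have := xab i (ltn_ord i); rewrite /f inord_val mxE.
rewrite (@nneseriesD1 _ _ k)//; last first.
  by move=> j _; rewrite mul1r lee_fin prodr_ge0// => i _; rewrite indicE.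
rewrite -[leLHS]adde0; apply: leeD; last first.
  by apply: nneseries_ge0 => j _ _; rewrite mul1r lee_fin prodr_ge0// => i _; rewrite indicE.
rewrite mul1r lee_fin big1// => i _; rewrite indicE mem_set//=.
by rewrite in_itv/=; have := yk i; rewrite /f inord_val mxE.
Qed.

Lemma measurable_coord i : measurable_fun setT (fun x : T => (x : 'rV[R]_N.+1) 0 i).
Proof.
apply: (measurability _ (RGenInftyO.measurableE R)) => _ [_ [t ->] <-].
rewrite setTI; have := caratheodory_halfspace i t; congr caratheodory_measurable.
Qed.

Lemma measurable_open_box a b : measurable (open_box a b : set T).
Proof.
rewrite (_ : open_box a b =
    \bigcap_i ((fun x : T => (x : 'rV[R]_N.+1) 0 i) @^-1` `]a 0 i, b 0 i[%classic)).
  apply: fin_bigcap_measurable => // i _; rewrite -[X in measurable X]setTI.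
  exact: measurable_coord.
apply/seteqP; split=> x /=; first by move=> xab i _ /=; rewrite in_itv/= xab.
by move=> xab i; have := xab i I; rewrite /= in_itv.
Qed.

Lemma lebesgue_rV_translate z A : mu ((fun x => x + z) @` A) = mu A.
Proof.
suff le z' B : (mu [set (x + z')%R | x in B] <= mu B)%E.
  apply/eqP; rewrite eq_le le/=; apply: le_trans (le (- z) _).
  apply: le_outer_measure => x Ax /=; exists (x + z); first by exists x.
  by rewrite addrK.
apply/lee_addgt0Pr => e e0.
have [->|muX] := eqVneq (mu B) +oo%E; first by rewrite addye// leey.
have /lebesgue_outer_seq_cover[p [q [Bpq /ltW pqX]]] : (mu B < mu B + e%:E)%E.
  rewrite lteDl ?lte_fin//; apply: fin_real; rewrite ltey muX andbT.
  by rewrite (lt_le_trans _ (measure_ge0 mu _)).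
apply: le_trans pqX.
rewrite [leRHS](_ : _ = \sum_(0 <= k <oo) (box_volume (p k + z') (q k + z'))%:E)%E.
  apply: lebesgue_outer_le_series => _ [x /Bpq[k _ xk] <-]; exists k => // i.
  by rewrite !mxE !ltrD2r.
apply: eq_eseriesr => k _; congr EFin; apply: eq_bigr => i _.
by rewrite !mxE opprD addrACA subrr addr0.
Qed.

(** Measurability is Caratheodory's condition here, so it suffices to translate the test set and to
    use the invariance of the outer measure. *)
Lemma measurable_translate z : measurable_fun setT ((fun x => x + z) : T -> T).
Proof.
move=> _ Y mY; rewrite setTI.
have {}mY : (@lebesgue_outer R N.+1).-caratheodory Y by [].
suff : (@lebesgue_outer R N.+1).-caratheodory [set x | Y (x + z)] by [].
have im B X : [set x + z | x in X `&` [set x | B (x + z)]] =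
    [set x + z | x in X] `&` B.
  apply/seteqP; split=> [_ [x [Xx Bx] <-]|_ [[x Xx <-] Bx]].
    by split=> //; exists x.
  by exists x.
move=> X; have := mY [set x + z | x in X].
rewrite -!im -[~` [set x | Y (x + z)]]/[set x | (~` Y) (x + z)].
by have := lebesgue_rV_translate z; rewrite /lebesgue_rV => tr; rewrite !tr.
Qed.

End lebesgue_rV_theory.

(** * Smooth functions *)

Section smooth_functions_of_one_variable.
Context {R : realType}.
Implicit Types (f g F : R -> R).

(** The powers in front of the exponential close the family under differentiation, up to linear
    combinations: the derivative of member [n] involves members [n.+1] and [n.+2]. *)
Definition flat_exp (n : nat) (x : R) : R :=
  if x <= 0 then 0 else x^-1 ^+ n * expR (- x^-1).

Lemma flat_exp_npos n x : x <= 0 -> flat_exp n x = 0.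
Proof. by rewrite /flat_exp => ->. Qed.

Lemma flat_exp_pos n x : 0 < x -> flat_exp n x = x^-1 ^+ n * expR (- x^-1).
Proof. by rewrite /flat_exp ltNge => /negPf ->. Qed.

Lemma flat_exp_ge0 n x : 0 <= flat_exp n x.
Proof.
rewrite /flat_exp; case: ifPn => //; rewrite -ltNge => x0.
by rewrite mulr_ge0 ?expR_ge0// exprn_ge0// invr_ge0 ltW.
Qed.

(** From exp y >= 1 + y^(n+1)/(n+1)! at y = 1/x. This bound gives the derivative at the origin. *)
Lemma flat_exp_le n x : 0 < x -> flat_exp n x <= (n.+1)`!%:R * x.
Proof.
move=> x0; rewrite flat_exp_pos// expRN.
have y0 : 0 <= x^-1 by rewrite invr_ge0 ltW.
have fac0 : (0 : R) < (n.+1)`!%:R by rewrite ltr0n fact_gt0.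
rewrite ler_pdivrMr ?expR_gt0//.
have := expR_ge1Dxn n y0 => le.
apply: (@le_trans _ _ ((n.+1)`!%:R * x * (1 + x^-1 ^+ n.+1 / (n.+1)`!%:R))).
  rewrite mulrDr mulr1 exprS.
  rewrite (_ : (n.+1)`!%:R * x * _ = x^-1 ^+ n); last first.
    by field; rewrite !gt_eqF.
  by rewrite lerDr mulr_ge0// ltW.
by rewrite ler_pM2l// mulr_gt0.
Qed.

Lemma is_derive_flat_exp n (x : R) :
  is_derive x 1 (flat_exp n) (- n%:R * flat_exp n.+1 x + flat_exp n.+2 x).
Proof.
have [x0|x0|->] := ltgtP x 0.
- apply: (@near_eq_is_derive _ _ _ (cst 0)); last first.
    by rewrite !flat_exp_npos ?ltW// mulr0 addr0; exact: is_derive_cst.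
  by near=> y; rewrite flat_exp_npos//; apply: ltW; near: y; exact: lt_nbhsl.
- apply: (@near_eq_is_derive _ _ _ (fun x : R => x^-1 ^+ n * expR (- x^-1))).
    near=> y; rewrite flat_exp_pos//; near: y; exact: lt_nbhsr.
  have xn0 : x != 0 by rewrite gt_eqF.
  have dV : is_derive x 1 (fun y : R => y^-1) (- x ^- 2).
    apply: is_derive_eq; first exact: (@is_deriveV _ id).
    by rewrite /= scaler1.
  have dX : is_derive x 1 (fun y : R => y^-1 ^+ n)
      ((n%:R * x^-1 ^+ n.-1) *: - x ^- 2).
    have := @is_deriveX _ _ (fun y : R => y^-1) n x 1 _ dV.
    by rewrite exprfctE.
  apply: is_derive_eq.
  rewrite !flat_exp_pos//; case: n {dX} => [|n].
    by rewrite /GRing.scale/=; field.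
  by rewrite /GRing.scale/= [RHS]/= !exprS; field.
- rewrite !flat_exp_npos// mulr0 addr0.
  have C0 : (0 : R) < (n.+2)`!%:R by rewrite ltr0n fact_gt0.
  suff cv : h^-1 *: ((flat_exp n \o shift 0) (h *: 1) - flat_exp n 0) @[h --> 0^'] --> (0 : R).
    by apply: DeriveDef; [apply/cvg_ex; exists 0|exact: cvg_lim].
  apply/cvgrPdist_le => e e0; near=> h.
  rewrite sub0r normrN /= addr0 [_ *: 1]mulr1 [flat_exp n 0]flat_exp_npos// subr0.
  have h0 : h != 0 by near: h; exact: nbhs_dnbhs_neq.
  have [hn|hp|] := ltgtP h 0; last by move/eqP; rewrite (negPf h0).
    by rewrite flat_exp_npos ?(ltW hn)// scaler0 normr0 ltW.
  (* On the right of 0 the difference quotient is the next member of the family, which tends to 0 by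
     the linear bound. *)
  have -> : h^-1 *: flat_exp n h = flat_exp n.+1 h.
    by rewrite /GRing.scale/= !flat_exp_pos// exprS mulrA.
  rewrite ger0_norm ?flat_exp_ge0//; apply: le_trans (flat_exp_le _ hp) _.
  rewrite mulrC -ler_pdivlMr//; apply: le_trans (ler_norm _) _.
  near: h; apply: dnbhs0_le; exact: divr_gt0.
Unshelve. all: by end_near. Qed.

(* The constructors are chosen to make the class closed under differentiation:
   its members are then smooth, without a computation of higher derivatives. *)
Inductive smooth1 : (R -> R) -> Prop :=
| smooth1_flat_exp n : smooth1 (flat_exp n)
| smooth1_cst c : smooth1 (cst c)
| smooth1D f g : smooth1 f -> smooth1 g -> smooth1 (fun x => f x + g x)
| smooth1M f g : smooth1 f -> smooth1 g -> smooth1 (fun x => f x * g x)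
| smooth1_affine f a b : smooth1 f -> smooth1 (fun x => f (a * x + b))
| smooth1_primitive F f : smooth1 f -> (forall x : R, is_derive x 1 F (f x)) ->
    smooth1 F.

Lemma smooth1_derive f : smooth1 f ->
  exists2 f', smooth1 f' & forall x : R, is_derive x 1 f (f' x).
Proof.
elim=> {f} [n|c|f g sf [f' sf' ff'] sg [g' sg' gg']
  |f g sf [f' sf' ff'] sg [g' sg' gg']|f a b sf [f' sf' ff']|F f sf _ Ff].
- exists (fun x => cst (- n%:R) x * flat_exp n.+1 x + flat_exp n.+2 x).
    apply: smooth1D; last exact: smooth1_flat_exp.
    by apply: smooth1M; [exact: smooth1_cst|exact: smooth1_flat_exp].
  by move=> x; exact: is_derive_flat_exp.
- by exists (cst 0); [exact: smooth1_cst|move=> x; exact: is_derive_cst].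
- exists (fun x => f' x + g' x); first exact: smooth1D.
  by move=> x; exact: is_deriveD.
- exists (fun x => f x * g' x + g x * f' x).
    by apply: smooth1D; exact: smooth1M.
  by move=> x; exact: is_deriveM.
- exists (fun x => f' (a * x + b) * cst a x).
    by apply: smooth1M; [exact: smooth1_affine|exact: smooth1_cst].
  move=> x; apply: (@is_derive1_comp _ f (fun x => a * x + b)) => //=.
  apply: is_derive_eq.
  by rewrite addr0 [_ *: _]mulr1.
- by exists f.
Qed.

Lemma is_derive_continuous f (x : R) d : is_derive x 1 f d -> {for x, continuous f}.
Proof. by move=> [fx _]; apply: differentiable_continuous; exact/derivable1_diffP. Qed.

Lemma smooth1_continuous f : smooth1 f -> continuous f.
Proof.
by move=> /smooth1_derive[f' _ ff'] x; exact: is_derive_continuous (ff' x).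
Qed.

End smooth_functions_of_one_variable.

(** * The bump and its primitive *)

Section bump.
Context {R : realType}.

(** The margins of 1/8 separate the bumps of adjacent cells and keep the fields built from them away
    from the boundary of the cube. *)
Definition bump (x : R) : R := flat_exp 0 (x - 8^-1) * flat_exp 0 (7 / 8 - x).

Lemma smooth1_bump : smooth1 bump.
Proof.
apply: smooth1M.
  rewrite (_ : (fun _ => _) = fun x : R => flat_exp 0 (1 * x + - 8^-1)).
    by apply: smooth1_affine; exact: smooth1_flat_exp.
  by apply/funext => x; rewrite mul1r.
rewrite (_ : (fun _ => _) = fun x : R => flat_exp 0 (-1 * x + 7 / 8)).
  by apply: smooth1_affine; exact: smooth1_flat_exp.
by apply/funext => x; rewrite mulN1r addrC.
Qed.

Lemma bump_ge0 x : 0 <= bump x.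
Proof. by rewrite mulr_ge0// flat_exp_ge0. Qed.

Lemma bump_le1 x : bump x <= 1.
Proof.
have le1 y : flat_exp 0 y <= 1 :> R.
  have [y0|y0] := leP y 0; first by rewrite flat_exp_npos.
  by rewrite flat_exp_pos// expr0 mul1r expR_le1 oppr_le0 invr_ge0 ltW.
by rewrite mulr_ile1// flat_exp_ge0.
Qed.

Lemma bump_supp x : bump x != 0 -> 8^-1 < x < 7 / 8.
Proof.
apply: contraR; rewrite negb_and -!leNgt /bump => /orP[x1|x1].
  by rewrite flat_exp_npos ?mul0r// subr_le0.
by rewrite [flat_exp _ (7 / 8 - x)]flat_exp_npos ?mulr0// subr_le0.
Qed.

Lemma bump_eq0 x : ~~ (8^-1 < x < 7 / 8) -> bump x = 0.
Proof. by apply: contraNeq; exact: bump_supp. Qed.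

(** On [1/4, 3/4] both arguments in [bump] are at least 1/8, so each factor is at least
    [expR (-8)]. *)
Definition bump_min : R := expR (-16).

Lemma bump_min_gt0 : 0 < bump_min. Proof. exact: expR_gt0. Qed.

Lemma bump_ge_min x : 4^-1 <= x <= 3 / 4 -> bump_min <= bump x.
Proof.
have ge y : 8^-1 <= y -> expR (-8) <= flat_exp 0 y :> R.
  move=> y8; have y0 : 0 < y by apply: lt_le_trans y8; rewrite invr_gt0.
  rewrite flat_exp_pos// expr0 mul1r ler_expR lerN2 -[leRHS]invrK.
  by rewrite lef_pV2 ?posrE ?invr_gt0.
move=> /andP[x1 x2]; rewrite /bump_min (_ : -16 = -8 + -8); last by ring.
by rewrite expRD ler_pM ?expR_ge0// ge//; lra.
Qed.

(** The bump is continuous and vanishes off [0, 1], hence is integrable on the line; integrating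
    from -oo gives a primitive at every point, with no left endpoint to treat apart. *)
Lemma bump_primitive_subproof : exists F : R -> R,
  forall x : R, is_derive x 1 F (bump x).
Proof.
have cb := smooth1_continuous smooth1_bump.
have ib : lebesgue_measure.-integrable setT (EFin \o bump).
  have -> : EFin \o bump = (EFin \o bump) \_ `[0, 1]%classic.
    apply/funext => x; rewrite patchE; case: ifPn => // xn /=.
    rewrite bump_eq0//; apply: contra xn => /andP[x1 x2].
    by rewrite inE/= in_itv/=; apply/andP; split; lra.
  have [+ _] := @integrable_mkcond _ _ _ lebesgue_measure `[0, 1]%classic
    (EFin \o bump) (measurable_itv _).
  apply; apply: continuous_compact_integrable.
    exact: segment_compact.
  exact: continuous_subspaceT.
exists (fun x => \int[lebesgue_measure]_(t in `]-oo, x]) bump t)%R => x.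
have [||||dF <-] := @continuous_FTC1 R bump -oo%O x (x + 1).
- by rewrite ltrDl.
- by apply: integrableS ib.
- exact: ltNyr.
- exact: cb.
by rewrite derive1E; exact: derivableP.
Qed.

Definition bump_primitive : R -> R := projT1 (cid bump_primitive_subproof).

(** A smooth step rising from 0 to [step 1]. The difference of two of its translates is a compactly
    supported primitive of the difference of the corresponding bumps. *)
Definition step (x : R) : R := bump_primitive x - bump_primitive 0.

Lemma is_derive_step (x : R) : is_derive x 1 step (bump x).
Proof.
have dB : is_derive x 1 bump_primitive (bump x).
  exact: (projT2 (cid bump_primitive_subproof)).
by apply: is_derive_eq; rewrite subr0.
Qed.

Lemma smooth1_step : smooth1 step.
Proof. exact: smooth1_primitive smooth1_bump is_derive_step. Qed.

Lemma step_MVT x y : x <= y ->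
  exists2 z, x <= z <= y & step y - step x = bump z * (y - x).
Proof.
move=> xy; have [||z] := @MVT_segment R step bump x y xy.
- by move=> z _; exact: is_derive_step.
- by apply: continuous_subspaceT; exact: smooth1_continuous smooth1_step.
by rewrite in_itv/= => xzy eq; exists z.
Qed.

Lemma le_step : {homo step : x y / x <= y}.
Proof.
move=> x y xy; have [z _ xyz] := step_MVT xy.
by rewrite -subr_ge0 xyz mulr_ge0 ?bump_ge0 ?subr_ge0.
Qed.

Lemma step_left x : x <= 8^-1 -> step x = 0.
Proof.
move=> x8; have s0 : step 0 = 0 by rewrite /step subrr.
have [x0|x0] := leP x 0.
  have [z /andP[_ z0]] := step_MVT x0; rewrite s0 bump_eq0 ?mul0r; lra.
have [z /andP[z0 zx]] := step_MVT (ltW x0); rewrite s0 bump_eq0 ?mul0r; lra.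
Qed.

Lemma step_right x : 7 / 8 <= x -> step x = step 1.
Proof.
move=> x7; have [x1|x1] := leP x 1.
  have [z /andP[z0 z1]] := step_MVT x1; rewrite bump_eq0 ?mul0r; lra.
have [z /andP[z0 z1]] := step_MVT (ltW x1); rewrite bump_eq0 ?mul0r; lra.
Qed.

Lemma step_ge0 x : 0 <= step x.
Proof.
have [x8|x8] := leP x 8^-1; first by rewrite step_left.
by rewrite -(step_left (lexx 8^-1)); exact/le_step/ltW.
Qed.

Lemma step_le1 x : step x <= 1.
Proof.
have s1 : step 1 <= 1.
  have [z _] := step_MVT ler01; rewrite (@step_left 0) ?invr_ge0// !subr0 mulr1.
  by move=> ->; exact: bump_le1.
have [x1|x1] := leP x 1; first exact: le_trans (le_step x1) s1.
by rewrite step_right//; lra.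
Qed.

End bump.

Section smooth_functions_of_several_variables.
Context {R : realType} {N : nat}.
Implicit Types (f g : 'rV[R]_N -> R) (x v : 'rV[R]_N).

(** The device of [smooth1] again: the class is closed under partial derivatives and its members are
    continuous, so all iterated partials are under control. *)
Inductive smooth_rV : ('rV[R]_N -> R) -> Prop :=
| smooth_rV_coord (i : 'I_N) (f : R -> R) :
    smooth1 f -> smooth_rV (fun x => f (x 0 i))
| smooth_rVD f g : smooth_rV f -> smooth_rV g -> smooth_rV (fun x => f x + g x)
| smooth_rVM f g : smooth_rV f -> smooth_rV g -> smooth_rV (fun x => f x * g x)
| smooth_rV_cst (c : R) : smooth_rV (cst c).

Lemma is_derive_coord (f : R -> R) (i j : 'I_N) x d :
  is_derive (x 0 j) 1 f d ->
  is_derive x (delta_mx 0 i) (fun y => f (y 0 j)) (d * (j == i)%:R).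
Proof.
move=> [fd dfE].
have E h : h^-1 *: (((fun y => f (y 0 j)) \o shift x) (h *: delta_mx 0 i) - f (x 0 j)) =
    (j == i)%:R * (h^-1 *: ((f \o shift (x 0 j)) (h *: 1) - f (x 0 j))).
  rewrite /= !mxE eqxx/= [_ *: 1]mulr1; case: (j == i); rewrite ?mulr1 ?mul1r//.
  by rewrite mulr0 add0r subrr scaler0 mul0r.
have cv : h^-1 *: (((fun y => f (y 0 j)) \o shift x) (h *: delta_mx 0 i) - f (x 0 j))
    @[h --> 0^'] --> (j == i)%:R * d.
  under eq_fun do rewrite E.
  by apply: cvgMr; rewrite -dfE; exact: fd.
rewrite mulrC; apply: DeriveDef; first by apply/cvg_ex; eexists; exact: cv.
exact: cvg_lim.
Qed.

Lemma smooth_rV_derive f (i : 'I_N) : smooth_rV f ->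
  exists2 f', smooth_rV f' & forall x, is_derive x (delta_mx 0 i) f (f' x).
Proof.
elim=> {f} [j f /smooth1_derive[f' sf' ff']|f g sf [f' sf' ff'] sg [g' sg' gg']
  |f g sf [f' sf' ff'] sg [g' sg' gg']|c].
- exists (fun x => f' (x 0 j) * cst (j == i)%:R x).
    by apply: smooth_rVM; [exact: smooth_rV_coord|exact: smooth_rV_cst].
  by move=> x; exact: is_derive_coord.
- exists (fun x => f' x + g' x); first exact: smooth_rVD.
  by move=> x; exact: is_deriveD.
- exists (fun x => f x * g' x + g x * f' x).
    by apply: smooth_rVD; exact: smooth_rVM.
  by move=> x; exact: is_deriveM.
- by exists (cst 0); [exact: smooth_rV_cst|move=> x; exact: is_derive_cst].
Qed.

Lemma smooth_rV_continuous f : smooth_rV f -> continuous f.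
Proof.
elim=> {f} [i f /smooth1_continuous cf|f g _ cf _ cg|f g _ cf _ cg|c] x.
- apply: (@continuous_comp _ _ _ (fun y : 'rV[R]_N => y 0 i) f); last exact: cf.
  exact: coord_continuous.
- exact: cvgD (cf x) (cg x).
- exact: cvgM (cf x) (cg x).
- exact: cst_continuous.
Qed.

Lemma smooth_rV_iter_partial f s : smooth_rV f -> smooth_rV (iter_partial s f).
Proof.
move=> sf; elim: s => //= i s IHs.
have [f' sf' ff'] := smooth_rV_derive i IHs.
rewrite (_ : partial _ _ = f')//; apply/funext => x; exact: derive_val.
Qed.

Lemma smooth_rV_smooth f : smooth_rV f -> smooth f.
Proof.
move=> sf s; have sfs := smooth_rV_iter_partial s sf.
split=> [|i x]; first exact: smooth_rV_continuous.
by have [f' _ ff'] := smooth_rV_derive i sfs; exact: ex_derive.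
Qed.

Lemma smooth_rV_sum (I : finType) (F : I -> 'rV[R]_N -> R) :
  (forall i, smooth_rV (F i)) -> smooth_rV (fun x => \sum_i F i x).
Proof.
move=> sF; elim: (index_enum I) => [|i s IHs].
  by under eq_fun do rewrite big_nil; exact: smooth_rV_cst.
by under eq_fun do rewrite big_cons; exact: smooth_rVD.
Qed.

Lemma smooth_rV_prod (I : finType) (P : pred I) (F : I -> 'rV[R]_N -> R) :
  (forall i, smooth_rV (F i)) -> smooth_rV (fun x => \prod_(i | P i) F i x).
Proof.
move=> sF; elim: (index_enum I) => [|i s IHs].
  by under eq_fun do rewrite big_nil; exact: smooth_rV_cst.
under eq_fun do rewrite big_cons; case: (P i) => //; exact: smooth_rVM.
Qed.

End smooth_functions_of_several_variables.

(** * The test fields of a grid *)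

Section coordinate_products.
Context {R : realType} {N : nat}.
Implicit Types (x : 'rV[R]_N).

(** Only the factor [i] depends on coordinate [i], so the others leave the difference quotient as
    the constant [P]. *)
Lemma is_derive_prod_coord (G : 'I_N -> R -> R) (i : 'I_N) x d :
  is_derive (x 0 i) 1 (G i) d ->
  is_derive x (delta_mx 0 i) (fun y => \prod_j G j (y 0 j))
    (d * \prod_(j | j != i) G j (x 0 j)).
Proof.
move=> [fd dfE]; set P := \prod_(j | _) _.
have E h : h^-1 *: (((fun y => \prod_j G j (y 0 j)) \o shift x) (h *: delta_mx 0 i) -
      \prod_j G j (x 0 j)) =
    P * (h^-1 *: ((G i \o shift (x 0 i)) (h *: 1) - G i (x 0 i))).
  rewrite /= (bigD1 i)//= [X in _ - X](bigD1 i)//= -/P.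
  rewrite !mxE !eqxx/= [_ *: 1]mulr1 mulr1.
  rewrite (eq_bigr (fun j => G j (x 0 j))) => [|j ji]; last first.
    by rewrite !mxE (negPf ji) andbF mulr0 add0r.
  by rewrite -/P -mulrBl /GRing.scale/=; ring.
have cv : h^-1 *: (((fun y => \prod_j G j (y 0 j)) \o shift x) (h *: delta_mx 0 i) -
      \prod_j G j (x 0 j)) @[h --> 0^'] --> P * d.
  under eq_fun do rewrite E.
  by apply: cvgMr; rewrite -dfE; exact: fd.
rewrite mulrC; apply: DeriveDef; first by apply/cvg_ex; eexists; exact: cv.
exact: cvg_lim.
Qed.

(* The product of [f] and [g] telescopes through the mixed products whose
   first [i] factors come from [g] and the others from [f]. *)
Lemma prodB_telescope (f g : 'I_N -> R) :
  \prod_j f j - \prod_j g j = \sum_i (f i - g i) *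
    \prod_(j | j != i) (if (j < i)%N then g j else f j).
Proof.
pose T (i : nat) := \prod_(j < N) (if (j < i)%N then g j else f j).
have -> : \prod_j f j = T 0 by apply: eq_bigr.
have -> : \prod_j g j = T N by apply: eq_bigr => j _; rewrite ltn_ord.
rewrite -opprB -(telescope_sumr _ (leq0n N)) big_mkord -sumrN.
apply: eq_bigr => i _; rewrite opprB /T (bigD1 i)//= ltnn.
rewrite [X in _ - X](bigD1 i)//= ltnSn mulrBl; congr (_ - _ * _).
by apply: eq_bigr => j ji; rewrite ltnS leq_eqVlt -[_ == _ :> nat]/(j == i) (negPf ji).
Qed.

End coordinate_products.

(** Meant for functions with disjoint supports evaluated at one point: a single term survives, so
    the number of terms does not enter the bound. *)
Lemma sum_le_unique_support {R : realType} {I : finType} (F : I -> R) (C : R) :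
  (forall i, 0 <= F i <= C) -> 0 <= C ->
  (forall i j, F i != 0 -> F j != 0 -> i = j) -> \sum_i F i <= C.
Proof.
move=> FC C0 uniqF; have [i Fi|F0] := pickP (fun i => F i != 0); last first.
  by rewrite big1// => i _; apply/eqP/negPn; rewrite F0.
rewrite (bigD1 i)//= big1 ?addr0; first by have /andP[] := FC i.
by move=> j; apply: contraNeq => Fj; apply/eqP; exact: uniqF.
Qed.

Section grid_field.
Context {R : realType} {N : nat}.
Variables (l : 'rV[R]_N.+1) (h : R) (n m : nat).
Hypotheses (h0 : 0 < h) (m0 : (0 < m)%N).
Local Notation cellT := {ffun 'I_N.+1 -> 'I_n * 'I_m}.
Local Notation pairT := {ffun 'I_N.+1 -> 'I_n * 'I_m * 'I_m}.
Implicit Types (x : 'rV[R]_N.+1) (i j : 'I_N.+1) (c : 'I_n * 'I_m)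
  (p : 'I_n * 'I_m * 'I_m) (K : cellT) (w : pairT).

(* [c = (j, a)] is the interval number [a] of the block number [j]. *)
Definition pos c : nat := c.1 * m + c.2.

Lemma ltn_pos c : (pos c < n * m)%N.
Proof.
case: c => j a; rewrite /pos /=; apply: (@leq_trans (j.+1 * m)).
  by rewrite mulSn addnC ltn_add2r.
by rewrite leq_mul2r ltn_ord orbT.
Qed.

Lemma pos_inj : injective pos.
Proof.
move=> [j a] [j' a']; rewrite /pos /= => e.
have ej : j = j' :> nat.
  have := congr1 (fun k => (k %/ m)%N) e.
  by rewrite !divnMDl// !divn_small// !addn0.
have ea : a = a' :> nat by move: e; rewrite ej => /addnI.
by congr pair; exact: val_inj.
Qed.

(* [p = (j, a, b)] encodes the pair of intervals [(j, a)], [(j, b)] of one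
   block. *)
Definition lft p : 'I_n * 'I_m := p.1.
Definition rgt p : 'I_n * 'I_m := (p.1.1, p.2).
Definition lcell w : cellT := [ffun i => lft (w i)].
Definition rcell w : cellT := [ffun i => rgt (w i)].

Definition bump_at c (t : R) : R := bump (t - (pos c)%:R).
Definition step_at c (t : R) : R := step (t - (pos c)%:R).
Definition scaled i x : R := h^-1 * (x 0 i - l 0 i).

Definition cell_bump K x : R := \prod_i bump_at (K i) (scaled i x).

(* In the field that moves the cell [lcell w] to [rcell w], the component [i]
   moves the coordinate [i], when the coordinates [j < i] are moved already. *)
Definition field_factor i j p (t : R) : R :=
  if j == i then step_at (lft p) t - step_at (rgt p) t
  else bump_at (if (j < i)%N then rgt p else lft p) t.

Definition grid_field (sg : pairT -> R) i x : R :=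
  \sum_w sg w * \prod_j field_factor i j (w j) (scaled j x).

Lemma smooth1_bump_at c a b : smooth1 (fun t : R => bump_at c (a * t + b)).
Proof.
rewrite /bump_at; under eq_fun do rewrite -addrA.
exact: smooth1_affine smooth1_bump.
Qed.

Lemma smooth1_step_at c a b : smooth1 (fun t : R => step_at c (a * t + b)).
Proof.
rewrite /step_at; under eq_fun do rewrite -addrA.
exact: smooth1_affine smooth1_step.
Qed.

Lemma smooth1_field_factor i j p :
  smooth1 (fun t : R => field_factor i j p (h^-1 * (t - l 0 j))).
Proof.
under eq_fun do rewrite mulrBr; rewrite /field_factor; case: eqP => _.
  apply: smooth1D; first exact: smooth1_step_at.
  rewrite (_ : (fun _ => _) = fun x : R => cst (-1) x *
      step_at (rgt p) (h^-1 * x + - (h^-1 * l 0 j))); last first.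
    by apply/funext => x; rewrite /= mulN1r.
  by apply: smooth1M; [exact: smooth1_cst|exact: smooth1_step_at].
exact: smooth1_bump_at.
Qed.

Lemma smooth_grid_field sg i (c : R) : smooth (fun x => c * grid_field sg i x).
Proof.
apply: smooth_rV_smooth; apply: smooth_rVM; first exact: smooth_rV_cst.
apply: smooth_rV_sum => w; apply: smooth_rVM; first exact: smooth_rV_cst.
apply: smooth_rV_prod => j.
exact: (smooth_rV_coord j (smooth1_field_factor i j (w j))).
Qed.

Lemma is_derive_scaled (f : R -> R) (t s d : R) :
  is_derive (h^-1 * (t - s)) 1 f d ->
  is_derive t 1 (fun t => f (h^-1 * (t - s))) (h^-1 * d).
Proof.
move=> fd; rewrite mulrC; apply: (@is_derive1_comp _ f (fun t => h^-1 * (t - s))) => //.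
by apply: is_derive_eq; rewrite subr0 [_ *: _]mulr1.
Qed.

(** Differentiating the factor [i] turns the difference of steps into the difference of bumps. What
    remains is the [i]-th term of [prodB_telescope] for the bumps of [lcell w] and [rcell w]. *)
Lemma is_derive_grid_field sg i (c : R) x :
  is_derive x (delta_mx 0 i) (fun x => c * grid_field sg i x)
    (c * h^-1 * \sum_w sg w *
      ((bump_at (lcell w i) (scaled i x) - bump_at (rcell w i) (scaled i x)) *
      \prod_(j | j != i) bump_at (if (j < i)%N then rcell w j else lcell w j)
        (scaled j x))).
Proof.
rewrite -mulrA mulr_sumr; apply: is_deriveZ.
rewrite /grid_field.
have : forall w, is_derive x (delta_mx 0 i)
  (fun x => sg w * \prod_j field_factor i j (w j) (scaled j x))
  (h^-1 * (sg w *
      ((bump_at (lcell w i) (scaled i x) - bump_at (rcell w i) (scaled i x)) *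
      \prod_(j | j != i) bump_at (if (j < i)%N then rcell w j else lcell w j)
        (scaled j x)))).
  move=> w; rewrite mulrCA; apply: is_deriveZ.
  have := @is_derive_prod_coord R N.+1
    (fun j t => field_factor i j (w j) (h^-1 * (t - l 0 j))) i x
    (h^-1 * (bump_at (lcell w i) (scaled i x) - bump_at (rcell w i) (scaled i x))).
  rewrite -mulrA => H; apply: is_derive_eq; first apply: H.
    apply: (@is_derive_scaled (field_factor i i (w i))).
    rewrite /field_factor eqxx !ffunE.
    have ds c' (t : R) : is_derive t 1 (step_at c') (bump_at c' t).
      rewrite -[bump_at _ _]mulr1.
      apply: (@is_derive1_comp _ step (fun t => t - (pos c')%:R)).
        exact: is_derive_step.
      by apply: is_derive_eq; rewrite subr0.
    exact: is_deriveB.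
  congr (_ * (_ * _)); apply: eq_bigr => j /negPf ji.
  by rewrite /field_factor ji !ffunE; case: ifP.
move=> dw; elim: (index_enum _) => [|w s IHs].
  by under eq_fun do rewrite big_nil; rewrite big_nil; exact: is_derive_cst.
under eq_fun do rewrite big_cons; rewrite big_cons; exact: is_deriveD.
Qed.

Lemma bump_at_ge0 c (t : R) : 0 <= bump_at c t. Proof. exact: bump_ge0. Qed.

Lemma bump_at_supp c (t : R) : bump_at c t != 0 ->
  (pos c)%:R + 8^-1 < t < (pos c)%:R + 7 / 8.
Proof. by move=> /bump_supp; lra. Qed.

Lemma bump_at_inj c c' (t : R) : bump_at c t != 0 -> bump_at c' t != 0 -> c = c'.
Proof.
move=> /bump_at_supp/andP[c1 c2] /bump_at_supp/andP[c3 c4]; apply: pos_inj.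
have lt1 (a b : nat) : a%:R < b%:R + 1 :> R -> (a <= b)%N.
  by rewrite natr1 ltr_nat ltnS.
by apply/eqP; rewrite eqn_leq !lt1//; lra.
Qed.

Lemma sum_bump_at (t : R) : \sum_c bump_at c t <= 1.
Proof.
apply: sum_le_unique_support => [c||c c'] //; last exact: bump_at_inj.
by rewrite bump_at_ge0 bump_le1.
Qed.

Lemma sum_cell_bump x : \sum_K cell_bump K x <= 1.
Proof.
rewrite /cell_bump -(bigA_distr_bigA (fun i c => bump_at c (scaled i x))).
apply: (@le_trans _ _ (\prod_(i < N.+1) 1)); last by rewrite big1.
by apply: ler_prod => i _; rewrite sum_bump_at sumr_ge0// => c _; exact: bump_at_ge0.
Qed.

Lemma sum_pair (F : 'I_n * 'I_m * 'I_m -> R) :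
  \sum_p F p = \sum_(j < n) \sum_(a < m) \sum_(b < m) F (j, a, b).
Proof. by rewrite pair_big/= pair_big/=; apply: eq_bigr => -[[]]. Qed.

(** At most one left interval is active at [t], and it belongs to [m] pairs. *)
Lemma sum_bump_lft (t : R) : \sum_p bump_at (lft p) t <= m%:R.
Proof.
rewrite sum_pair /lft/=.
under eq_bigr do under eq_bigr do rewrite sumr_const card_ord -mulr_natr.
under eq_bigr do rewrite -mulr_suml.
rewrite -mulr_suml -[leRHS]mul1r ler_wpM2r//.
rewrite pair_big/=; apply: le_trans (sum_bump_at t).
by rewrite le_eqVlt; apply/orP; left; apply/eqP; apply: eq_bigr => -[].
Qed.

Lemma sum_bump_rgt (t : R) : \sum_p bump_at (rgt p) t <= m%:R.
Proof.
rewrite sum_pair /rgt/=.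
under eq_bigr do rewrite exchange_big/=.
under eq_bigr do under eq_bigr do rewrite sumr_const card_ord -mulr_natr.
under eq_bigr do rewrite -mulr_suml.
rewrite -mulr_suml -[leRHS]mul1r ler_wpM2r//.
rewrite pair_big/=; apply: le_trans (sum_bump_at t).
by rewrite le_eqVlt; apply/orP; left; apply/eqP; apply: eq_bigr => -[].
Qed.

(** Both intervals lie in the same block: to its left both steps are 0, to its right both equal
    [step 1]. *)
Lemma step_at_supp p (t : R) :
  step_at (lft p) t - step_at (rgt p) t != 0 ->
  (p.1.1 * m)%:R + 8^-1 < t < (p.1.1 * m)%:R + m%:R - 8^-1.
Proof.
have posD c : (c.1 * m)%:R <= (pos c)%:R :> R by rewrite ler_nat leq_addr.
have posM c : (pos c)%:R + 1 <= (c.1 * m)%:R + m%:R :> R.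
  by rewrite natr1 -natrD ler_nat /pos -addnS leq_add2l.
have := posD (lft p); have := posD (rgt p); have := posM (lft p); have := posM (rgt p).
rewrite [(lft p).1]/(p.1.1) [(rgt p).1]/(p.1.1).
move=> rM lM rD lD; apply: contraR; rewrite negb_and -!leNgt /step_at.
move=> /orP[t1|t1].
  by rewrite !step_left ?subrr//; lra.
by rewrite [X in X - _]step_right ?[X in _ - X]step_right ?subrr//; lra.
Qed.

(** All [m * m] pairs of a block may be active at [t], but only one block is. Pairing cells within
    blocks thus makes the bound independent of [n]. *)
Lemma sum_step (t : R) :
  \sum_p `|step_at (lft p) t - step_at (rgt p) t| <= (m * m)%:R.
Proof.
rewrite sum_pair.
have le1 p : `|step_at (lft p) t - step_at (rgt p) t| <= 1.
  rewrite ler_norml /step_at.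
  have := step_ge0 (t - (pos (lft p))%:R); have := step_ge0 (t - (pos (rgt p))%:R).
  have := step_le1 (t - (pos (lft p))%:R); have := step_le1 (t - (pos (rgt p))%:R).
  by move=> *; apply/andP; split; lra.
apply: sum_le_unique_support => // [j|j j'].
  apply/andP; split; first by do 2!apply: sumr_ge0 => ? _.
  apply: (@le_trans _ _ (\sum_(a < m) \sum_(b < m) 1)).
    by do 2!apply: ler_sum => ? _; exact: le1.
  by rewrite sumr_const card_ord sumr_const card_ord -mulrnA.
have supp (k : 'I_n) : \sum_(a < m) \sum_(b < m)
      `|step_at (lft (k, a, b)) t - step_at (rgt (k, a, b)) t| != 0 ->
    (k * m)%:R + 8^-1 < t < (k * m)%:R + m%:R - 8^-1.
  apply: contraNT => tk; rewrite big1// => a _; rewrite big1// => b _.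
  by apply/eqP; rewrite normr_eq0; apply: contraNT tk; exact: step_at_supp.
move=> /supp/andP[j1 j2] /supp/andP[j1' j2'].
have le (a b : nat) : (a * m)%:R + 8^-1 < (b * m)%:R + m%:R - 8^-1 :> R -> (a <= b)%N.
  move=> ab; have : (a * m)%:R < (b * m)%:R + m%:R :> R by lra.
  by rewrite -natrD ltr_nat addnC -mulSn ltn_pmul2r.
apply/val_inj/eqP; rewrite eqn_leq !le//; lra.
Qed.

(** Since [w] chooses its interval pairs independently, the sum of products is a product of sums:
    coordinate [i] contributes at most [m * m] and each of the [N] others at most [m]. *)
Lemma norm_grid_field sg i x : (forall w, `|sg w| <= 1) ->
  `|grid_field sg i x| <= m%:R ^+ N.+2.
Proof.
move=> sg1; apply: le_trans (ler_norm_sum _ _ _) _.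
apply: (@le_trans _ _ (\sum_(w : pairT) \prod_j `|field_factor i j (w j) (scaled j x)|)).
  apply: ler_sum => w _; rewrite normrM -normr_prod -[leRHS]mul1r.
  by rewrite ler_wpM2r// sg1.
rewrite -(bigA_distr_bigA (fun j p => `|field_factor i j p (scaled j x)|)).
rewrite (bigD1 i)//= exprS exprS mulrA -natrM.
apply: ler_pM.
- by apply: sumr_ge0 => p _.
- by apply: prodr_ge0 => j _; apply: sumr_ge0 => p _.
- rewrite (eq_bigr (fun p => `|step_at (lft p) (scaled i x) - step_at (rgt p) (scaled i x)|)).
    exact: sum_step.
  by move=> p _; rewrite /field_factor eqxx.
- rewrite (_ : m%:R ^+ N = \prod_(j < N.+1 | j != i) m%:R); last first.
    by rewrite prodr_const cardC1 card_ord.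
  apply: ler_prod => j /negPf ji; rewrite sumr_ge0//= /field_factor ji.
  under eq_bigr do rewrite ger0_norm ?bump_at_ge0//.
  by case: (j < i)%N; [exact: sum_bump_rgt|exact: sum_bump_lft].
Qed.

Lemma field_factor_supp i j p (t : R) : field_factor i j p t != 0 ->
  8^-1 <= t <= (n * m)%:R - 8^-1.
Proof.
have pos_le c : (0 <= (pos c)%:R :> R) && ((pos c)%:R <= (n * m)%:R - 1 :> R).
  by rewrite ler0n lerBrDr natr1 ler_nat ltn_pos.
rewrite /field_factor; case: (j == i); last first.
  by move=> /bump_at_supp; have := pos_le (if (j < i)%N then rgt p else lft p); lra.
move=> /step_at_supp.
have : (p.1.1 * m)%:R + m%:R <= (n * m)%:R :> R.
  by rewrite -natrD ler_nat addnC -mulSn leq_mul2r ltn_ord orbT.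
have : 0 <= (p.1.1 * m)%:R :> R by rewrite ler0n.
lra.
Qed.

Lemma grid_field_supp sg i x : grid_field sg i x != 0 ->
  forall j, l 0 j + h / 8 <= x 0 j <= l 0 j + h * (n * m)%:R - h / 8.
Proof.
move=> fx j; have [w] : exists w, \prod_j field_factor i j (w j) (scaled j x) != 0.
  apply/existsP; apply: contraNT fx; rewrite negb_exists => /forallP w0.
  rewrite /grid_field big1// => w _.
  by have /negPn/eqP -> := w0 w; rewrite mulr0.
move=> /prodf_neq0/(_ j isT)/field_factor_supp; rewrite /scaled.
rewrite mulrC ler_pdivlMr// ler_pdivrMr//; lra.
Qed.

End grid_field.

Section test_vector_field.
Context {R : realType} {N : nat}.
Variables (x0 : 'rV[R]_N.+1) (r h : R) (n m : nat).
Hypotheses (h0 : 0 < h) (m0 : (0 < m)%N) (hr : h * (n * m)%:R = r).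
Local Notation cellT := {ffun 'I_N.+1 -> 'I_n * 'I_m}.
Local Notation pairT := {ffun 'I_N.+1 -> 'I_n * 'I_m * 'I_m}.
Let l : 'rV[R]_N.+1 := x0 - const_mx (r / 2).
Implicit Types (x : 'rV[R]_N.+1) (i j : 'I_N.+1) (sg : pairT -> R).

(** [m ^ N.+2] bounds each component; the factor [N.+1] turns this into a bound on the Euclidean
    norm, not sharp but sufficient. *)
Definition field_bound : R := N.+1%:R * m%:R ^+ N.+2.

Lemma field_bound_gt0 : 0 < field_bound.
Proof. by rewrite mulr_gt0// exprn_gt0// ltr0n. Qed.

Definition grid_vector sg x : 'rV[R]_N.+1 :=
  \row_i (field_bound^-1 * grid_field l h sg i x).

Lemma euclidean_norm_le1 (v : 'rV[R]_N.+1) :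
  (forall i, `|v 0 i| <= N.+1%:R^-1) -> euclidean_norm v <= 1.
Proof.
move=> v1; rewrite /euclidean_norm -[leRHS]sqrtr1 ler_wsqrtr//.
apply: (@le_trans _ _ (\sum_(i < N.+1) N.+1%:R^-1)).
  apply: ler_sum => i _; rewrite -real_normK ?num_real//.
  apply: le_trans (v1 i); rewrite expr2 ler_piMr//; apply: le_trans (v1 i) _.
  by rewrite invf_le1 ?ler1n.
by rewrite sumr_const card_ord -[leLHS]mulr_natl divff.
Qed.

(** The margins of the bumps confine the field to the closed box [S], at distance [h / 8] from the
    faces of the cube; [S] is compact and contains the closure of the support. *)
Lemma test_field_grid_vector sg : (forall w, `|sg w| <= 1) ->
  test_field (cube x0 r) (grid_vector sg).
Proof.
move=> sg1.
pose S := [set x : 'rV[R]_N.+1 | forall j,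
  `[l 0 j + h / 8, l 0 j + r - h / 8]%classic (x 0 j)].
have cS : compact S.
  apply: (@rV_compact _ _ (fun j => `[l 0 j + h / 8, l 0 j + r - h / 8]%classic)).
  by move=> j; exact: segment_compact.
have clS : closed S by apply: compact_closed => //; exact: norm_hausdorff.
have suppS : closure [set x | grid_vector sg x != 0] `<=` S.
  rewrite [X in _ `<=` X](closure_id S).1//; apply: closure_subset => x /= fx.
  have [i fi] : exists i, grid_vector sg x 0 i != 0.
    apply/existsP; apply: contraNT fx; rewrite negb_exists => /forallP f0.
    by apply/eqP/rowP => i; have /negPn/eqP -> := f0 i; rewrite mxE.
  have : grid_field l h sg i x != 0.
    by apply: contraNneq fi => f0; rewrite mxE f0 mulr0.
  by move=> /(grid_field_supp h0) H j /=; rewrite in_itv/= -hr; exact: H.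
split.
- move=> i; rewrite (_ : (fun _ => _) = fun x => field_bound^-1 * grid_field l h sg i x).
    exact: smooth_grid_field.
  by apply/funext => x; rewrite mxE.
- by apply: subclosed_compact cS suppS; exact: closed_closure.
- apply: subset_trans suppS _ => x Sx i; have := Sx i; rewrite /= in_itv/= !mxE.
  have : 0 < h by []. lra.
- move=> x _; apply: euclidean_norm_le1 => i; rewrite mxE normrM.
  rewrite ger0_norm ?invr_ge0 ?(ltW field_bound_gt0)// /field_bound invfM -mulrA.
  rewrite -[leRHS]mulr1 ler_wpM2l ?invr_ge0//.
  rewrite mulrC ler_pdivrMr ?exprn_gt0 ?ltr0n// mul1r.
  exact: norm_grid_field.
Qed.

(** For each [w], the partial derivatives add up to the telescoping sum of [prodB_telescope]. *)
Lemma divergence_grid_vector sg x : divergence (grid_vector sg) x =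
  (field_bound * h)^-1 *
  \sum_w sg w * (cell_bump l h (lcell w) x - cell_bump l h (rcell w) x).
Proof.
rewrite /divergence.
under eq_bigr => i _.
  rewrite (_ : (fun _ => _) = fun x => field_bound^-1 * grid_field l h sg i x); last first.
    by apply/funext => y; rewrite mxE.
  rewrite /partial (@derive_val _ _ _ _ _ _ _ (is_derive_grid_field l h sg i _ x)).
  over.
rewrite /= [(field_bound * h)^-1]invfM -[LHS]mulr_sumr; congr (_ * _).
rewrite exchange_big/=; apply: eq_bigr => w _.
by rewrite -mulr_sumr; congr (_ * _); rewrite /cell_bump prodB_telescope;
  apply: eq_bigr => i _; congr (_ * _); apply: eq_bigr => j _; case: ifP.
Qed.

End test_vector_field.

(** * Testing a function of bounded variation against the grid fields *)

Section Rintegral_finite_sums.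
Context d (T : measurableType d) (R : realType) (mu : {measure set T -> \bar R}).
Variables (D : set T) (mD : measurable D).

Lemma Rintegral_sum (I : finType) (f : I -> T -> R) :
  (forall i, mu.-integrable D (EFin \o f i)) ->
  \int[mu]_(x in D) (\sum_i f i x) = \sum_i \int[mu]_(x in D) f i x.
Proof.
move=> intf; rewrite /Rintegral.
under eq_integral do rewrite -sumEFin.
rewrite (integral_sum mD intf) -sum_fine// => i _.
exact: integrable_fin_num.
Qed.

Lemma integrable_finite_sum (I : finType) (f : I -> T -> R) :
  (forall i, mu.-integrable D (EFin \o f i)) ->
  mu.-integrable D (EFin \o (fun x => \sum_i f i x)).
Proof.
move=> intf.
have -> : EFin \o (fun x => \sum_i f i x) = (fun x => \sum_i (f i x)%:E)%E.
  by apply/funext => x /=; rewrite sumEFin.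
by apply: (integrable_sum mD) => i _; exact: intf.
Qed.

Lemma integrable_bounded_mul (u f : T -> R) (M : R) :
  mu.-integrable D (EFin \o u) -> measurable_fun D f ->
  (forall x, `|f x| <= M) -> mu.-integrable D (fun x => (u x * f x)%:E).
Proof.
move=> intu mf fM; have := integrableMl mD intu mf; apply.
by exists M; split; [exact: num_real|move=> y My x _; exact/ltW/(le_lt_trans (fM x))].
Qed.

Lemma integrable_scale (k : R) (f : T -> R) : mu.-integrable D (EFin \o f) ->
  mu.-integrable D (EFin \o (fun x => k * f x)).
Proof. exact: integrableZl. Qed.

Lemma integrable_sub (f g : T -> R) : mu.-integrable D (EFin \o f) ->
  mu.-integrable D (EFin \o g) -> mu.-integrable D (EFin \o (fun x => f x - g x)).
Proof. exact: integrableB. Qed.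

Lemma measurable_sum (I : finType) (f : I -> T -> R) (P : pred I) :
  (forall i, measurable_fun D (f i)) -> measurable_fun D (fun x => \sum_(i | P i) f i x).
Proof.
move=> mf; elim: (index_enum I) => [|i s IHs].
  by under eq_fun do rewrite big_nil; exact: measurable_cst.
under eq_fun do rewrite big_cons; case: (P i) => //.
exact: measurable_funD.
Qed.

Lemma measurable_prod (I : finType) (f : I -> T -> R) (P : pred I) :
  (forall i, measurable_fun D (f i)) -> measurable_fun D (fun x => \prod_(i | P i) f i x).
Proof.
move=> mf; elim: (index_enum I) => [|i s IHs].
  by under eq_fun do rewrite big_nil; exact: measurable_cst.
under eq_fun do rewrite big_cons; case: (P i) => //.
exact: measurable_funM.
Qed.

End Rintegral_finite_sums.

Section duality_estimate.
Context {R : realType} {N : nat}.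
Variables (x0 : 'rV[R]_N.+1) (r h : R) (n m : nat).
Hypotheses (h0 : 0 < h) (m0 : (0 < m)%N) (hr : h * (n * m)%:R = r).
Local Notation cellT := {ffun 'I_N.+1 -> 'I_n * 'I_m}.
Local Notation pairT := {ffun 'I_N.+1 -> 'I_n * 'I_m * 'I_m}.
Local Notation T := (lebesgue_space R N.+1).
Local Notation mu := (@lebesgue_rV R N.+1).
Let l : 'rV[R]_N.+1 := x0 - const_mx (r / 2).
Let Q : set T := cube x0 r.
Implicit Types (K : cellT) (w : pairT) (u : T -> R).

Lemma measurable_cube (x : 'rV[R]_N.+1) (s : R) : measurable (cube x s : set T).
Proof. exact: measurable_open_box. Qed.

Lemma measurable_cell_bump K (D : set T) : measurable_fun D (cell_bump l h K : T -> R).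
Proof.
apply: measurable_funTS.
have -> : cell_bump l h K = fun x => \prod_i bump_at (K i) (scaled l h i x) by [].
apply: (@measurable_prod _ T R setT 'I_N.+1
  (fun i x => bump_at (K i) (scaled l h i x)) xpredT) => i.
pose f (t : R) := bump_at (K i) (h^-1 * (t - l 0 i)).
have mf : measurable_fun setT f.
  apply: continuous_measurable_fun; apply: smooth1_continuous.
  by rewrite /f; under eq_fun do rewrite mulrBr; exact: smooth1_bump_at.
exact: measurableT_comp mf (measurable_coord i).
Qed.

Lemma cell_bump_ge0 K x : 0 <= cell_bump l h K x.
Proof. by apply: prodr_ge0 => i _; exact: bump_at_ge0. Qed.

Lemma cell_bump_le1 K x : cell_bump l h K x <= 1.
Proof.
apply: (@le_trans _ _ (\prod_(i < N.+1) 1)); last by rewrite big1.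
by apply: ler_prod => i _; rewrite bump_at_ge0 bump_le1.
Qed.

Lemma norm_cell_bump K x : `|cell_bump l h K x| <= 1.
Proof. by rewrite ger0_norm ?cell_bump_ge0 ?cell_bump_le1. Qed.

Definition cell_mass u K : R := \int[mu]_(x in Q) (u x * cell_bump l h K x).

Lemma integrable_cell_mass u K : mu.-integrable Q (EFin \o u) ->
  mu.-integrable Q (EFin \o (fun x => u x * cell_bump l h K x)).
Proof.
move=> intu; apply: (@integrable_bounded_mul _ T R mu Q _ u _ 1) => //.
- exact: measurable_cube.
- exact: measurable_cell_bump.
- exact: norm_cell_bump.
Qed.

(** Taking [sg w] to be the sign of the difference for [w] turns the integral of [u] against one
    divergence into the whole sum of absolute values, so [V] is paid only once. *)
Lemma sum_cell_mass_diff u (V : R) :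
  mu.-integrable Q (EFin \o u) -> (BV_seminorm (Q : set 'rV[R]_N.+1) u <= V%:E)%E ->
  \sum_w `|cell_mass u (lcell w) - cell_mass u (rcell w)| <=
    @field_bound R N m * h * V.
Proof.
move=> intu BVu.
pose sg w : R := Num.sg (cell_mass u (lcell w) - cell_mass u (rcell w)).
have sg1 w : `|sg w| <= 1 by rewrite normr_sg lern1 leq_b1.
have phiP := test_field_grid_vector x0 h0 m0 hr sg1.
have /le_trans/(_ BVu) : (\int[mu]_(x in Q)
    (u x * divergence (grid_vector x0 r h sg) x)%:E <=
    BV_seminorm (Q : set 'rV[R]_N.+1) u)%E.
  by apply: ereal_sup_ubound; exists (grid_vector x0 r h sg).
have int_diff w : mu.-integrable Q (EFin \o (fun x =>
    u x * cell_bump l h (lcell w) x - u x * cell_bump l h (rcell w) x)).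
  apply: integrable_sub; first exact: measurable_cube.
  - exact: integrable_cell_mass.
  - exact: integrable_cell_mass.
pose c := (@field_bound R N m * h)^-1.
have c0 : 0 < @field_bound R N m * h by rewrite mulr_gt0// field_bound_gt0.
have int_pair w : mu.-integrable Q (EFin \o (fun x => c * sg w *
    (u x * cell_bump l h (lcell w) x - u x * cell_bump l h (rcell w) x))).
  apply: integrable_scale; [exact: measurable_cube|exact: int_diff].
rewrite (eq_integral (fun x => (\sum_w c * sg w *
    (u x * cell_bump l h (lcell w) x - u x * cell_bump l h (rcell w) x))%:E)); last first.
  move=> x _; congr EFin; rewrite divergence_grid_vector// -/c mulrCA !mulr_sumr.
  by apply: eq_bigr => w _; rewrite -/l; ring.
under eq_integral do rewrite -sumEFin.
rewrite (integral_sum (measurable_cube _ _) int_pair).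
rewrite (eq_bigr (fun w => (c * `|cell_mass u (lcell w) - cell_mass u (rcell w)|)%:E)).
  rewrite sumEFin lee_fin -mulr_sumr /c => le.
  by rewrite -ler_pdivrMl.
move=> w _; rewrite -[LHS]fineK; last first.
  exact: (integrable_fin_num (measurable_cube _ _) (int_pair w)).
congr EFin; rewrite -[LHS]/(\int[mu]_(x in Q) (c * sg w *
    (u x * cell_bump l h (lcell w) x - u x * cell_bump l h (rcell w) x))).
rewrite RintegralZl//.
- rewrite RintegralB//.
  + by rewrite -mulrA -/(cell_mass _ _) -/(cell_mass _ _) /sg normrEsg.
  + exact: measurable_cube.
  + exact: integrable_cell_mass.
  + exact: integrable_cell_mass.
- exact: measurable_cube.
Qed.

End duality_estimate.

(** * Cells and bumps *)

Section cell_weight.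
Context {R : realType} {N : nat}.
Variables (x0 : 'rV[R]_N.+1) (r h : R) (n m : nat).
Hypotheses (h0 : 0 < h) (m0 : (0 < m)%N) (hr : h * (n * m)%:R = r).
Local Notation cellT := {ffun 'I_N.+1 -> 'I_n * 'I_m}.
Local Notation T := (lebesgue_space R N.+1).
Local Notation mu := (@lebesgue_rV R N.+1).
Let l : 'rV[R]_N.+1 := x0 - const_mx (r / 2).
Let Q : set T := cube x0 r.
Implicit Types (K : cellT) (x : 'rV[R]_N.+1).

Lemma cubeP x : cube x0 r x <-> forall i, l 0 i < x 0 i < l 0 i + r.
Proof.
by split=> xQ i; have := xQ i; rewrite !mxE; lra.
Qed.

Lemma lebesgue_cube_lty : (mu Q < +oo)%E.
Proof.
exact: le_lt_trans (lebesgue_outer_box_le (@subset_refl _ _)) (ltry _).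
Qed.

Lemma cell_bump_supp K x : cell_bump l h K x != 0 ->
  forall i, l 0 i + h * (pos (K i))%:R + h / 8 < x 0 i <
            l 0 i + h * (pos (K i))%:R + h * (7 / 8).
Proof.
move=> /prodf_neq0 H i; have /bump_at_supp := H i isT; rewrite /scaled.
rewrite mulrC ltr_pdivlMr// ltr_pdivrMr//; lra.
Qed.

Lemma cell_bump_supp_cube K x : cell_bump l h K x != 0 -> cube x0 r x.
Proof.
move=> /cell_bump_supp Kx; apply/cubeP => i; have := Kx i.
have : h * ((pos (K i))%:R + 1) <= r.
  by rewrite -hr ler_pM2l// natr1 ler_nat; exact: ltn_pos.
have : 0 <= h * (pos (K i))%:R by rewrite mulr_ge0// ltW.
by have := h0; lra.
Qed.

(** The bump of the cell in the corner [l]. All cell bumps are translates of it and share its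
    integral, [cell_weight]. *)
Definition base_bump x : R := \prod_i bump (scaled l h i x).

Definition cell_shift K : 'rV[R]_N.+1 := \row_i (- (h * (pos (K i))%:R)).

Lemma cell_bump_shift K x : cell_bump l h K x = base_bump (x + cell_shift K).
Proof.
apply: eq_bigr => i _; rewrite /bump_at /scaled !mxE; congr bump.
by field; rewrite gt_eqF.
Qed.

Lemma base_bump_ge0 x : 0 <= base_bump x.
Proof. by apply: prodr_ge0 => i _; exact: bump_ge0. Qed.

Lemma measurable_base_bump (D : set T) : measurable_fun D (base_bump : T -> R).
Proof.
apply: measurable_funTS.
have -> : base_bump = fun x => \prod_i bump (scaled l h i x) by [].
apply: (@measurable_prod _ T R setT 'I_N.+1
  (fun i x => bump (scaled l h i x)) xpredT) => i.
pose f (t : R) := bump (h^-1 * (t - l 0 i)).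
have mf : measurable_fun setT f.
  apply: continuous_measurable_fun; apply: smooth1_continuous.
  rewrite /f; under eq_fun do rewrite mulrBr.
  by apply: smooth1_affine; exact: smooth1_bump.
exact: measurableT_comp mf (measurable_coord i).
Qed.

Lemma integral_translate (z : 'rV[R]_N.+1) (f : T -> R) :
  measurable_fun setT f -> (forall x, 0 <= f x) ->
  (\int[mu]_x (f (x + z))%:E = \int[mu]_x (f x)%:E)%E.
Proof.
move=> mf f0.
have mz := @measurable_translate R N z.
rewrite [RHS](@eq_measure_integral _ _ _ _ (pushforward mu (fun x : T => (x + z) : T))).
  rewrite ge0_integral_pushforward.
  - by rewrite preimage_setT.
  - exact: mz.
  - exact: measurableT.
  - exact/measurable_EFinP.
  - by move=> x _; rewrite lee_fin.
move=> A mA _; change (mu A = mu [set x | A (x + z)]).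
rewrite -[RHS](lebesgue_rV_translate z).
congr lebesgue_rV; apply/seteqP; split=> [x Ax|_ [x Ax <-]] //=.
by exists (x - z); rewrite /= subrK.
Qed.

Lemma integral_cell_bump K :
  (\int[mu]_(x in Q) (cell_bump l h K x)%:E = \int[mu]_x (base_bump x)%:E)%E.
Proof.
rewrite -(integral_translate (cell_shift K) (@measurable_base_bump setT) base_bump_ge0).
rewrite integral_mkcond; apply: eq_integral => x _; rewrite patchE -cell_bump_shift.
case: ifPn => // /negP; rewrite inE => Qx; congr EFin; apply/esym/eqP.
by apply/negPn/negP => /cell_bump_supp_cube.
Qed.

(** On the concentric box of side [h / 2] every factor is at least [bump_min]. *)
Lemma integral_base_bump_ge :
  (((bump_min * (h / 2)) ^+ N.+1)%:E <= \int[mu]_x (base_bump x)%:E)%E.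
Proof.
pose a : 'rV[R]_N.+1 := l + const_mx (h / 4).
pose b : 'rV[R]_N.+1 := l + const_mx (h * (3 / 4)).
have mab := @measurable_open_box R N a b.
apply: (@le_trans _ _ (\int[mu]_(x in open_box a b) (bump_min ^+ N.+1)%:E)%E).
  rewrite integral_cst// exprMn EFinM.
  apply: lee_wpmul2l; first by rewrite lee_fin exprn_ge0// ltW// bump_min_gt0.
  apply: le_trans (box_volume_le_lebesgue a b); rewrite lee_fin box_volume_incl.
    rewrite -[in leLHS](card_ord N.+1) -prodr_const.
    rewrite le_eqVlt; apply/orP; left; apply/eqP; apply: eq_bigr => i _.
    by rewrite !mxE; field.
  by move=> i; rewrite !mxE; have := h0; lra.
apply: (@le_trans _ _ (\int[mu]_(x in open_box a b) (base_bump x)%:E)%E).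
  apply: ge0_le_integral; first exact: mab.
  - by move=> x _; rewrite lee_fin exprn_ge0// ltW// bump_min_gt0.
  - exact: measurable_cst.
  - exact/measurable_EFinP/measurable_base_bump.
  - move=> x xab; rewrite lee_fin -[in leLHS](card_ord N.+1) -prodr_const.
    apply: ler_prod => i _; rewrite (ltW bump_min_gt0) bump_ge_min// /scaled.
    rewrite mulrC ler_pdivlMr// ler_pdivrMr//.
    by have := xab i; rewrite !mxE; have := h0; lra.
apply: ge0_subset_integral; [exact: mab|exact: measurableT| | |exact: subsetT].
- exact/measurable_EFinP/measurable_base_bump.
- by move=> x _; rewrite lee_fin base_bump_ge0.
Qed.

Lemma integrable_cell_bump K : mu.-integrable Q (EFin \o (cell_bump l h K : T -> R)).
Proof.
apply: measurable_bounded_integrable.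
- exact: measurable_cube.
- exact: lebesgue_cube_lty.
- exact: measurable_cell_bump.
exists 1; split; first exact: num_real.
by move=> y y1 x _; exact/ltW/(le_lt_trans (norm_cell_bump _ _ _ _ _)).
Qed.

Definition cell_weight : R := fine (\int[mu]_x (base_bump x)%:E)%E.

Lemma Rintegral_cell_bump K : \int[mu]_(x in Q) cell_bump l h K x = cell_weight.
Proof. by rewrite /Rintegral integral_cell_bump. Qed.

Lemma cell_weight_ge : (0 < n)%N -> (bump_min * (h / 2)) ^+ N.+1 <= cell_weight.
Proof.
move=> n0; have K : cellT by exact: [ffun=> (Ordinal n0, Ordinal m0)].
have := integrable_fin_num (measurable_cube _ _) (integrable_cell_bump K).
rewrite -lee_fin /cell_weight -(integral_cell_bump K) => fin; rewrite fineK//.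
by rewrite integral_cell_bump; exact: integral_base_bump_ge.
Qed.

End cell_weight.

Section cells.
Context {R : realType} {N : nat}.
Variables (x0 : 'rV[R]_N.+1) (r h : R) (n m : nat).
Hypotheses (h0 : 0 < h) (m0 : (0 < m)%N) (hr : h * (n * m)%:R = r).
Local Notation cellT := {ffun 'I_N.+1 -> 'I_n * 'I_m}.
Local Notation T := (lebesgue_space R N.+1).
Local Notation mu := (@lebesgue_rV R N.+1).
Let l : 'rV[R]_N.+1 := x0 - const_mx (r / 2).
Let Q : set T := cube x0 r.
Implicit Types (K : cellT) (x : 'rV[R]_N.+1) (v : cellT -> R).

(* Half-open, so that the cells meeting the cube partition it. *)
Definition cell K : set T := [set x : 'rV[R]_N.+1 | forall i,
  l 0 i + h * (pos (K i))%:R <= x 0 i < l 0 i + h * ((pos (K i))%:R + 1)].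

Lemma measurable_cell K : measurable (cell K).
Proof.
rewrite (_ : cell K = \bigcap_i ((fun x : T => (x : 'rV[R]_N.+1) 0 i) @^-1`
    `[l 0 i + h * (pos (K i))%:R, l 0 i + h * ((pos (K i))%:R + 1)[%classic)).
  apply: fin_bigcap_measurable => // i _; rewrite -[X in measurable X]setTI.
  exact: measurable_coord.
apply/seteqP; split=> x /=; first by move=> xK i _ /=; rewrite in_itv/= xK.
by move=> xK i; have := xK i I; rewrite /= in_itv.
Qed.

Lemma cell_inj K K' x : cell K x -> cell K' x -> K = K'.
Proof.
move=> xK xK'; apply/ffunP => i; apply: (pos_inj m0).
have /andP[a1 a2] := xK i; have /andP[b1 b2] := xK' i.
have lt1 (a b : nat) : h * a%:R < h * (b%:R + 1) -> (a <= b)%N.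
  by rewrite ltr_pM2l// natr1 ltr_nat ltnS.
by apply/eqP; rewrite eqn_leq !lt1//; lra.
Qed.

Lemma cell_exists x : cube x0 r x -> exists K, cell K x.
Proof.
move=> /cubeP; rewrite -/l => xQ.
have sc0 i : 0 <= scaled l h i x.
  by rewrite /scaled mulr_ge0 ?invr_ge0 ?(ltW h0)//; have := xQ i; lra.
have k_lt i : (Num.truncn (scaled l h i x) < n * m)%N.
  rewrite -(@ltr_nat R); have /andP[le_sc _] := truncn_itv (sc0 i).
  apply: le_lt_trans le_sc _.
  by rewrite /scaled mulrC ltr_pdivrMr// mulrC hr; have := xQ i; lra.
have n0 i : (Num.truncn (scaled l h i x) %/ m < n)%N by rewrite ltn_divLR.
have km i : (Num.truncn (scaled l h i x) %% m < m)%N by rewrite ltn_pmod.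
(* Euclidean division by [m] splits the integer part of the scaled coordinate into the block number
   and the interval number. *)
exists [ffun i => (Ordinal (n0 i), Ordinal (km i))] => i.
rewrite ffunE /pos/= -divn_eq.
have /andP[t1 t2] := truncn_itv (sc0 i).
have e : h * scaled l h i x = x 0 i - l 0 i.
  by rewrite /scaled mulrA divff ?mul1r// gt_eqF.
have {}t1 : h * (Num.truncn (scaled l h i x))%:R <= x 0 i - l 0 i.
  by rewrite -e ler_pM2l.
have {}t2 : x 0 i - l 0 i < h * ((Num.truncn (scaled l h i x))%:R + 1).
  by rewrite -e ltr_pM2l// natr1.
by apply/andP; split; lra.
Qed.

(** A half-open cell must be enlarged to fit into an open box; adding [h / 2] at both ends gives
    sides [2 * h], and the loss only affects constants. *)
Lemma lebesgue_cell_le K : (mu (cell K) <= ((2 * h) ^+ N.+1)%:E)%E.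
Proof.
pose a : 'rV[R]_N.+1 := \row_i (l 0 i + h * (pos (K i))%:R - h / 2).
pose b : 'rV[R]_N.+1 := \row_i (l 0 i + h * ((pos (K i))%:R + 1) + h / 2).
apply: (@le_trans _ _ (box_volume a b)%:E).
  apply: lebesgue_outer_box_le => x xK i; have := xK i; rewrite !mxE.
  by have := h0; lra.
rewrite lee_fin box_volume_incl => [|i]; last by rewrite !mxE; have := h0; lra.
rewrite -[in leRHS](card_ord N.+1) -prodr_const le_eqVlt; apply/orP; left.
by apply/eqP; apply: eq_bigr => i _; rewrite !mxE; field.
Qed.

Lemma cell_bump_cell K x : cell_bump l h K x != 0 -> cell K x.
Proof.
move=> /(cell_bump_supp h0) xK i; have := xK i; rewrite mulrDr mulr1.
by have := h0; lra.
Qed.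

Definition step_fun v x : R := \sum_K v K * \1_(cell K) x.

Lemma step_funE v K x : cell K x -> step_fun v x = v K.
Proof.
move=> xK; rewrite /step_fun (bigD1 K)//= indicE mem_set// mulr1 big1 ?addr0//.
move=> K' K'K; rewrite indicE memNset ?mulr0// => xK'.
by move/eqP: K'K; apply; exact: cell_inj xK' xK.
Qed.

Lemma measurable_step_fun v (D : set T) : measurable_fun D (step_fun v : T -> R).
Proof.
apply: measurable_funTS.
have -> : step_fun v = fun x => \sum_K v K * \1_(cell K) x by [].
apply: (@measurable_sum _ T R setT cellT (fun K x => v K * \1_(cell K) x) xpredT) => K.
apply: measurable_funM; first exact: measurable_cst.
exact/measurable_indic/measurable_cell.
Qed.

Lemma norm_step_fun v x : `|step_fun v x| <= \sum_K `|v K|.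
Proof.
apply: le_trans (ler_norm_sum _ _ _) _; apply: ler_sum => K _.
by rewrite normrM ler_piMr// indicE; case: (_ \in _); rewrite ?normr1 ?normr0.
Qed.

Lemma integrable_bounded (f : T -> R) (M : R) : measurable_fun Q f ->
  (forall x, `|f x| <= M) -> mu.-integrable Q (EFin \o f).
Proof.
move=> mf fM; apply: measurable_bounded_integrable.
- exact: measurable_cube.
- exact: lebesgue_cube_lty.
- exact: mf.
exists M; split; first exact: num_real.
by move=> y My x _; exact/ltW/(le_lt_trans (fM x)).
Qed.

Lemma integrable_step_fun v : mu.-integrable Q (EFin \o (step_fun v : T -> R)).
Proof.
by apply: integrable_bounded (norm_step_fun v); exact: measurable_step_fun.
Qed.

Definition step_error (u : T -> R) v : R :=
  \int[mu]_(x in Q) `|u x - step_fun v x|.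

Lemma integrable_error (u : T -> R) v : mu.-integrable Q (EFin \o u) ->
  mu.-integrable Q (EFin \o (fun x => `|u x - step_fun v x|)).
Proof.
move=> intu; apply: integrable_norm.
  by apply: integrable_sub; [exact: measurable_cube| |exact: integrable_step_fun].
Qed.

(** The bump of [K] lives in the cell [K], so it sees the step function as the constant [v K]. The
    remainders are integrals of [u - step_fun v] against bumps whose sum is at most 1. *)
Lemma sum_cell_mass_error (u : T -> R) v : mu.-integrable Q (EFin \o u) ->
  \sum_K `|cell_mass x0 r h u K - v K * cell_weight x0 r h| <= step_error u v.
Proof.
move=> intu.
have mQ : measurable Q by exact: measurable_cube.
pose d x := u x - step_fun v x.
have intd : mu.-integrable Q (EFin \o d).
  by apply: integrable_sub => //; exact: integrable_step_fun.
have intn : mu.-integrable Q (EFin \o (fun x => `|d x|)) by exact: integrable_norm.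
have intM (f : T -> R) K : mu.-integrable Q (EFin \o f) ->
    mu.-integrable Q (EFin \o (fun x => f x * cell_bump l h K x)).
  exact: integrable_cell_mass.
apply: (@le_trans _ _ (\sum_K \int[mu]_(x in Q) (`|d x| * cell_bump l h K x))).
  apply: ler_sum => K _.
  have -> : cell_mass x0 r h u K - v K * cell_weight x0 r h =
      \int[mu]_(x in Q) (d x * cell_bump l h K x).
    rewrite -(Rintegral_cell_bump x0 h0 hr K) -RintegralZl; first last.
    - exact: integrable_cell_bump.
    - exact: mQ.
    rewrite /cell_mass -RintegralB//; first last.
    - apply: integrable_scale => //; exact: integrable_cell_bump.
    - exact: intM.
    apply: eq_Rintegral => x _; rewrite /d mulrBl; congr (_ - _).
    have [->|/cell_bump_cell xK] := eqVneq (cell_bump l h K x) 0.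
      by rewrite !mulr0.
    by rewrite (step_funE v xK).
  apply: le_trans (le_normr_Rintegral mQ (intM _ K intd)) _.
  rewrite le_eqVlt; apply/orP; left; apply/eqP; apply: eq_Rintegral => x _.
  by rewrite normrM; congr (_ * _); rewrite ger0_norm// cell_bump_ge0.
rewrite -Rintegral_sum//; last by move=> K; exact: intM.
apply: le_Rintegral => //.
  by apply: integrable_finite_sum => // K; exact: intM.
move=> x _; rewrite -mulr_sumr ler_piMr//; exact: sum_cell_bump.
Qed.

End cells.

(** * Density of the step functions in L^1 *)

Section l1_distance.
Context d (T : measurableType d) (R : realType) (mu : {measure set T -> \bar R}).
Variables (D : set T) (mD : measurable D).
Implicit Types f g k : T -> R.

(** Valued in [\bar R], so that the triangle inequality can be used for measurable functions before
    integrability is discussed. *)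
Definition l1_dist f g : \bar R := (\int[mu]_(x in D) (`|f x - g x|)%:E)%E.

Lemma measurable_distance f g : measurable_fun D f -> measurable_fun D g ->
  measurable_fun D (fun x => (`|f x - g x|)%:E).
Proof.
move=> mf mg; apply/measurable_EFinP; apply: measurableT_comp => //.
exact: measurable_funB.
Qed.

Lemma l1_dist_triangle f g k : measurable_fun D f -> measurable_fun D g ->
  measurable_fun D k -> (l1_dist f k <= l1_dist f g + l1_dist g k)%E.
Proof.
move=> mf mg mk; rewrite /l1_dist -ge0_integralD//; do 1?exact: measurable_distance.
apply: ge0_le_integral => //; first exact: measurable_distance.
- by apply: emeasurable_funD; exact: measurable_distance.
- by move=> x _; rewrite -EFinD lee_fin ler_distD.
Qed.

Lemma l1_distD f g f' g' : measurable_fun D f -> measurable_fun D g ->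
  measurable_fun D f' -> measurable_fun D g' ->
  (l1_dist (fun x => f x + g x)%R (fun x => f' x + g' x)%R <=
    l1_dist f f' + l1_dist g g')%E.
Proof.
move=> mf mg mf' mg'; rewrite /l1_dist -ge0_integralD//; do 1?exact: measurable_distance.
apply: ge0_le_integral => //.
- by apply: measurable_distance; exact: measurable_funD.
- by apply: emeasurable_funD; exact: measurable_distance.
- by move=> x _; rewrite -EFinD lee_fin opprD addrACA ler_normD.
Qed.

Lemma l1_distZ c f g : measurable_fun D f -> measurable_fun D g ->
  l1_dist (fun x => c * f x) (fun x => c * g x) = (`|c|%:E * l1_dist f g)%E.
Proof.
move=> mf mg; rewrite /l1_dist -ge0_integralZl//; last exact: measurable_distance.
by apply: eq_integral => x _; rewrite -mulrBr normrM EFinM.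
Qed.

End l1_distance.

Section finite_cover.
Context {R : realType} {N : nat}.

Lemma lebesgue_finite_cover (I : finType) (A : set 'rV[R]_N.+1)
    (F : I -> set 'rV[R]_N.+1) : (forall x, A x -> exists i, F i x) ->
  (lebesgue_rV N.+1 A <= \sum_i lebesgue_rV N.+1 (F i))%E.
Proof.
move=> AF; have {}AF x : A x -> exists2 i, i \in index_enum I & F i x.
  by move=> /AF[i Fi]; exists i => //; exact: mem_index_enum.
elim: (index_enum I) A AF => [|i s IHs] A AF.
  rewrite big_nil (_ : A = set0) ?measure0//.
  by apply/seteqP; split=> x // /AF[].
rewrite big_cons; have -> : A = (A `&` F i) `|` (A `\` F i) by rewrite setUIDK.
apply: le_trans (outer_measureU2 (@lebesgue_outer R N.+1) _ _) _.
apply: leeD; first by apply: le_outer_measure => x [].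
apply: IHs => x [/AF[j]]; rewrite inE => /predU1P[->//|js Fj _].
by exists j.
Qed.

End finite_cover.

Section step_approximation.
Context {R : realType} {N : nat}.
Variables (x0 : 'rV[R]_N.+1) (r : R) (n : nat).
Hypotheses (r0 : 0 < r) (n0 : (0 < n)%N).
Local Notation T := (lebesgue_space R N.+1).
Local Notation mu := (@lebesgue_rV R N.+1).
Let Q : set T := cube x0 r.
Let mQ : measurable Q. Proof. exact: measurable_cube. Qed.
Local Notation l1 := (l1_dist mu Q).

Definition mesh (m : nat) : R := r / (n * m)%:R.

(** Asking for all large [m] lets two functions be approximated on a common grid. [n] stays fixed
    because it determines [eta]. *)
Definition step_approximable (f : T -> R) : Prop := forall e : R, 0 < e ->
  exists m1 : nat, forall m, (m1 <= m)%N -> (0 < m)%N ->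
    exists v : {ffun 'I_N.+1 -> 'I_n * 'I_m} -> R,
      (l1 f (step_fun x0 r (mesh m) v) <= e%:E)%E.

Lemma mesh_gt0 m : (0 < m)%N -> 0 < mesh m.
Proof. by move=> m0; rewrite divr_gt0// ltr0n muln_gt0 n0. Qed.

Lemma meshE m : (0 < m)%N -> mesh m * (n * m)%:R = r.
Proof. by move=> m0; rewrite divfK// pnatr_eq0 -lt0n muln_gt0 n0. Qed.

Lemma measurable_step_funQ m (v : {ffun 'I_N.+1 -> 'I_n * 'I_m} -> R) :
  measurable_fun Q (step_fun x0 r (mesh m) v : T -> R).
Proof. exact: measurable_step_fun. Qed.

Lemma step_approximableD f g : measurable_fun Q f -> measurable_fun Q g ->
  step_approximable f -> step_approximable g ->
  step_approximable (fun x => f x + g x).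
Proof.
move=> mf mg af ag e e0; have e2 : 0 < e / 2 by rewrite divr_gt0.
have [m1 m1P] := af _ e2; have [m2 m2P] := ag _ e2.
exists (maxn m1 m2) => m; rewrite geq_max => /andP[m1m m2m] m0.
have [v vP] := m1P m m1m m0; have [w wP] := m2P m m2m m0.
exists (fun K => v K + w K).
have -> : step_fun x0 r (mesh m) (fun K => v K + w K) =
    fun x => step_fun x0 r (mesh m) v x + step_fun x0 r (mesh m) w x.
  apply/funext => x; rewrite /step_fun -big_split/=.
  by apply: eq_bigr => K _; rewrite mulrDl.
have mv := measurable_step_funQ v; have mw := measurable_step_funQ w.
apply: le_trans (l1_distD mu mQ mf mg mv mw) _.
by rewrite [e]splitr EFinD; apply: leeD.
Qed.

Lemma step_approximableZ c f : measurable_fun Q f ->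
  step_approximable f -> step_approximable (fun x => c * f x).
Proof.
move=> mf af e e0.
have c1 : 0 < `|c| + 1 by rewrite ltr_wpDl.
have [m1 m1P] := af (e / (`|c| + 1)) (divr_gt0 e0 c1).
exists m1 => m m1m m0; have [v vP] := m1P m m1m m0.
exists (fun K => c * v K).
have -> : step_fun x0 r (mesh m) (fun K => c * v K) =
    fun x => c * step_fun x0 r (mesh m) v x.
  apply/funext => x; rewrite /step_fun mulr_sumr.
  by apply: eq_bigr => K _; rewrite mulrA.
rewrite (l1_distZ mu mQ c mf (measurable_step_funQ v)).
apply: (@le_trans _ _ (`|c|%:E * (e / (`|c| + 1))%:E)%E).
  by apply: lee_wpmul2l => //; rewrite lee_fin.
rewrite -EFinM lee_fin mulrA ler_pdivrMr// mulrC ler_pM2l// lerDl.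
exact: ler01.
Qed.

Lemma step_approximable0 : step_approximable (cst 0).
Proof.
move=> e e0; exists 0%N => m _ m0.
pose v : {ffun 'I_N.+1 -> 'I_n * 'I_m} -> R := fun=> 0; exists v.
have -> : step_fun x0 r (mesh m) v = cst 0.
  by apply/funext => x; rewrite /step_fun big1// => K _; rewrite mul0r.
rewrite /l1_dist; under eq_integral do rewrite subrr normr0.
by rewrite integral0 lee_fin ltW.
Qed.

Lemma step_approximable_limit f : measurable_fun Q f ->
  (forall e : R, 0 < e -> exists g,
    [/\ measurable_fun Q g, step_approximable g & (l1 f g <= e%:E)%E]) ->
  step_approximable f.
Proof.
move=> mf lim e e0; have e2 : 0 < e / 2 by rewrite divr_gt0.
have [g [mg ag fg]] := lim _ e2; have [m1 m1P] := ag _ e2.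
exists m1 => m m1m m0; have [v vP] := m1P m m1m m0; exists v.
apply: le_trans (l1_dist_triangle mu mQ mf mg (measurable_step_funQ v)) _.
by rewrite [e]splitr EFinD; apply: leeD.
Qed.

Definition center m (K : {ffun 'I_N.+1 -> 'I_n * 'I_m}) : 'rV[R]_N.+1 :=
  \row_i ((x0 - const_mx (r / 2)) 0 i + mesh m * ((pos (K i))%:R + 2^-1)).

Definition slab (i : 'I_N.+1) (t e : R) : set T :=
  [set x : 'rV[R]_N.+1 | `|x 0 i - t| < e].

Lemma measurable_slab i t e : measurable (slab i t e).
Proof.
rewrite (_ : slab i t e = (fun x : T => (x : 'rV[R]_N.+1) 0 i) @^-1`
    `]t - e, t + e[%classic).
  by rewrite -[X in measurable X]setTI; exact: measurable_coord.
by apply/seteqP; split=> x; rewrite /slab /= in_itv/= ltr_distl.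
Qed.

Lemma lebesgue_slab_cube i t e : 0 <= e ->
  (mu (slab i t e `&` Q) <= (2 * e * (2 * r) ^+ N)%:E)%E.
Proof.
move=> e0; apply: (@lebesgue_outer_slab _ _ _ i x0 t e r) => //; first exact: ltW.
move=> x [xt xQ]; split=> // j; rewrite ltr_distl; have := xQ j; rewrite !mxE.
have := r0; lra.
Qed.

Lemma cell_center_dist m (m0 : (0 < m)%N) (K : {ffun 'I_N.+1 -> 'I_n * 'I_m}) x i :
  cell x0 r (mesh m) K x -> `|x 0 i - center K 0 i| < mesh m.
Proof.
move=> xK; have := xK i; have := mesh_gt0 m0; rewrite ltr_distl !mxE.
set h := mesh m; set c := _ - _; set p := (pos _)%:R; rewrite !mulrDr mulr1; lra.
Qed.

Definition box_union (p q : nat -> 'rV[R]_N.+1) (k : nat) : set T :=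
  \bigcup_(j in [set j | (j < k)%N]) open_box (p j) (q j).

Lemma measurable_box_union p q k : measurable (box_union p q k).
Proof. by apply: bigcup_measurable => j _; exact: measurable_open_box. Qed.

(* The step function tests the centers of the cells; it errs only within one
   mesh of the hyperplanes that carry the faces of the boxes. *)
Lemma step_approximable_box_union p q k :
  step_approximable (\1_(box_union p q k) : T -> R).
Proof.
move=> e e0; set O := box_union p q k.
(* One term for each of the two faces of each box in each direction: a slab of half-width [h] around
   it meets the cube in measure at most [h] times this term. The choice of [m] below makes
   [h * C <= e]. *)
pose C : R := \sum_(a : 'I_k * 'I_N.+1 * bool) (2 * (2 * r) ^+ N).
have C0 : 0 <= C by apply: sumr_ge0 => a _; rewrite mulr_ge0// exprn_ge0// mulr_ge0// ltW.
exists (Num.truncn (e^-1 * (r * C))).+1 => m mC m0.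
exists (fun K => \1_O (center K)).
set h := mesh m; have h0 : 0 < h by exact: mesh_gt0.
have hC : h * C <= e.
  rewrite /h /mesh mulrAC ler_pdivrMr ?ltr0n ?muln_gt0 ?n0//.
  rewrite mulrC -ler_pdivrMl// mulrC.
  apply: le_trans (ltW (truncnS_gt _)) _; rewrite ler_nat.
  by apply: leq_trans mC _; rewrite leq_pmull.
pose S (a : 'I_k * 'I_N.+1 * bool) : set T :=
  slab a.1.2 ((if a.2 then p a.1.1 else q a.1.1) 0 a.1.2) h.
pose B := \bigcup_a S a.
have mB : measurable B.
  by apply: fin_bigcup_measurable => // a _; exact: measurable_slab.
apply: (@le_trans _ _ (\int[mu]_(x in Q) (\1_B x)%:E)%E); last first.
  rewrite (integral_indic _ mQ mB).
  apply: (@le_trans _ _ (\sum_a mu (S a `&` Q))%E).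
    by apply: lebesgue_finite_cover => x [[a _ Sa] Qx]; exists a.
  apply: (@le_trans _ _ (\sum_(a : 'I_k * 'I_N.+1 * bool)
      (2 * h * (2 * r) ^+ N)%:E)%E).
    by apply: lee_sum => a _; apply: lebesgue_slab_cube; exact: ltW.
  rewrite sumEFin lee_fin; apply: le_trans hC; rewrite /C mulr_sumr.
  by rewrite le_eqVlt; apply/orP; left; apply/eqP; apply: eq_bigr => a _; ring.
apply: ge0_le_integral; first exact: mQ.
- by move=> x _; rewrite lee_fin.
- apply: measurable_distance; last exact: measurable_step_funQ.
  exact/measurable_indic/measurable_box_union.
- by apply/measurable_EFinP; exact: measurable_indic.
move=> x Qx; rewrite lee_fin.
have [K xK] := cell_exists h0 m0 (meshE m0) Qx.
rewrite (step_funE h0 m0 _ xK).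
have [xB|xB] := boolP (x \in B).
  rewrite [leRHS]indicE xB !indicE.
  by case: (x \in O); case: (center K \in O);
    rewrite /= ?subrr ?normr0 ?subr0 ?sub0r ?normrN ?normr1.
suff -> : \1_O x = \1_O (center K) :> R by rewrite subrr normr0 indicE.
(* Off [B], every coordinate of [x] is at least [h] away from every face, while the center is closer
   than [h] to [x]: both lie on the same side of each face. *)
have dx i : `|x 0 i - center K 0 i| < h by exact: cell_center_dist.
have far (j : 'I_k) i (b : bool) :
    h <= `|x 0 i - (if b then p j else q j) 0 i|.
  rewrite leNgt; apply/negP => xj; move/negP: xB; apply; rewrite inE.
  by exists (j, i, b).
rewrite !indicE; congr (_%:R); congr nat_of_bool.
have farp (j : 'I_k) i := far j i true; have farq (j : 'I_k) i := far j i false.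
apply/idP/idP; rewrite !inE => -[j jk] xj; exists j => // i;
  have := farp (Ordinal jk) i; have := farq (Ordinal jk) i;
  have := dx i; have := xj i; rewrite /= ltr_distl !ler_normr; lra.
Qed.

(** A nearly optimal cover of [A] in the cube has union [O] with small excess, and dropping the tail
    of its volume series leaves finitely many boxes. Where the two indicators differ in the cube,
    the point lies in one of these two small differences. *)
Lemma step_approximable_indic (A : set T) : measurable A ->
  step_approximable (\1_A : T -> R).
Proof.
move=> mA; apply: step_approximable_limit; first exact: measurable_indic.
move=> e e0; have e2 : 0 < e / 2 by rewrite divr_gt0.
have AQfin : (mu (A `&` Q) < +oo)%E.
  apply: le_lt_trans (lebesgue_cube_lty x0 r).
  by apply: le_outer_measure => x [].
have AQnum : mu (A `&` Q) \is a fin_num.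
  by rewrite ge0_fin_numE.
have /lebesgue_outer_seq_cover[p [q [AQpq pqlt]]] :
    (mu (A `&` Q) < mu (A `&` Q) + (e / 2)%:E)%E by rewrite lteDl.
have vol0 j : (0 <= (box_volume (p j) (q j))%:E)%E.
  by rewrite lee_fin box_volume_ge0.
have [k tail] : exists k,
    (\sum_(k <= j <oo) (box_volume (p j) (q j))%:E < (e / 2)%:E)%E.
  have : (\sum_(k <= j <oo) (box_volume (p j) (q j))%:E @[k --> \oo] --> 0)%E.
    by apply: nneseries_tail_cvg => //; apply: lt_le_trans pqlt _; exact: leey.
  move=> /fine_cvgP[fink] /cvgrPdist_lt/(_ _ e2) small.
  near \oo => k; exists k.
  have kfin : (\sum_(k <= j <oo) (box_volume (p j) (q j))%:E)%E \is a fin_num.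
    by near: k.
  rewrite -(fineK kfin) lte_fin; apply: le_lt_trans (ler_norm _) _.
  by rewrite -normrN -sub0r; near: k.
pose O : set T := \bigcup_j open_box (p j) (q j).
have mO : measurable O by apply: bigcup_measurable => j _; exact: measurable_open_box.
have OAQ : (mu (O `\` (A `&` Q)) <= (e / 2)%:E)%E.
  have := measureDI mu mO (measurableI _ _ mA mQ).
  rewrite (_ : O `&` (A `&` Q) = A `&` Q); last exact/setIidPr.
  have := lebesgue_outer_le_series (@subset_refl _ O); rewrite -/(mu O) => Opq OE.
  have : (mu (O `\` (A `&` Q)) + mu (A `&` Q) <= (e / 2)%:E + mu (A `&` Q))%E.
    rewrite -OE; apply: le_trans Opq _; rewrite addeC; exact: ltW.
  by rewrite leeD2rE.
have OOk : (mu (O `\` box_union p q k) <= (e / 2)%:E)%E.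
  apply: le_trans (ltW tail); rewrite -nneseries_addn//.
  apply: lebesgue_outer_le_series => x [[j _ xj] xk].
  have [jk|kj] := ltnP j k; first by exfalso; apply: xk; exists j.
  by exists (j - k)%N => //; rewrite subnK.
exists (\1_(box_union p q k)); split.
- exact/measurable_indic/measurable_box_union.
- exact: step_approximable_box_union.
have mD1 : measurable (O `\` (A `&` Q)) by apply: measurableD => //; exact: measurableI.
have mD2 : measurable (O `\` box_union p q k).
  by apply: measurableD => //; exact: measurable_box_union.
apply: (@le_trans _ _ (mu ((O `\` (A `&` Q)) `&` Q) +
    mu ((O `\` box_union p q k) `&` Q))%E); last first.
  rewrite [e]splitr EFinD; apply: leeD.
    by apply: le_trans OAQ; apply: le_outer_measure => x [].
  by apply: le_trans OOk; apply: le_outer_measure => x [].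
rewrite -(integral_indic _ mQ mD1) -(integral_indic _ mQ mD2).
rewrite -ge0_integralD; first last.
- by apply/measurable_EFinP; exact: measurable_indic.
- by move=> x _; rewrite lee_fin indicE.
- by apply/measurable_EFinP; exact: measurable_indic.
- by move=> x _; rewrite lee_fin indicE.
- exact: mQ.
apply: ge0_le_integral; first exact: mQ.
- by move=> x _; rewrite lee_fin.
- apply: measurable_distance; first exact: measurable_indic.
  exact/measurable_indic/measurable_box_union.
- by apply: emeasurable_funD; apply/measurable_EFinP; exact: measurable_indic.
move=> x Qx; rewrite -EFinD lee_fin.
have ind01 (B : set T) : (0 : R) <= \1_B x by rewrite indicE.
have [xA|xA] := boolP (x \in A); have [xk|xk] := boolP (x \in box_union p q k);
  rewrite ![in leLHS]indicE ?xA ?xk ?(negPf xA) ?(negPf xk) /= ?subrr ?normr0 ?addr_ge0//.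
- rewrite subr0 normr1 -[leLHS]add0r lerD// indicE mem_set//; split.
    by apply: AQpq; split=> //; exact: set_mem.
  by move=> xk'; move/negP: xk; apply; exact: mem_set.
- rewrite sub0r normrN normr1 -[leLHS]addr0 lerD// indicE mem_set//; split.
    by have [j _ xj] := set_mem xk; exists j.
  by move=> [xA' _]; move/negP: xA; apply; exact: mem_set.
Unshelve. all: by end_near. Qed.

(** Simple functions approximate [u] in L^1, and each is a finite combination of indicators of
    measurable sets. *)
Lemma step_approximable_integrable (u : T -> R) :
  mu.-integrable Q (EFin \o u) -> step_approximable u.
Proof.
move=> intu; apply: step_approximable_limit.
  by have /integrableP[/measurable_EFinP] := intu.
move=> e e0; have [g_ [intg _]] := approximation_sfun_integrable mQ intu.
move=> /fine_cvgP[fing] /cvgrPdist_lt/(_ _ e0) small.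
near \oo => k; exists (g_ k).
have mg : measurable_fun Q (g_ k) by exact: measurable_funTS.
have kfin : (\int[mu]_(z in Q) `|(EFin \o u) z - (g_ k z)%:E|)%E \is a fin_num.
  by near: k.
split=> //; last first.
  rewrite /l1_dist -[leLHS]/(\int[mu]_(z in Q) `|(EFin \o u) z - (g_ k z)%:E|)%E.
  rewrite -(fineK kfin) lee_fin; apply: le_trans (ler_norm _) _; apply: ltW.
  by rewrite -normrN -sub0r; near: k.
have -> : (g_ k : T -> R) = fun x => \sum_(y <- finmap.enum_fset (fset_set (range (g_ k))))
    (y * \1_(g_ k @^-1` [set y]) x).
  by apply/funext => x; rewrite fimfunE fsbig_finite.
elim: (finmap.enum_fset _) => [|y s IHs].
  by under eq_fun do rewrite big_nil; exact: step_approximable0.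
under eq_fun do rewrite big_cons.
have mi z : measurable_fun Q (fun x => z * \1_(g_ k @^-1` [set z]) x : R).
  by apply: measurable_funM; [exact: measurable_cst|exact: measurable_indic].
apply: step_approximableD; [exact: mi| | |exact: IHs].
  elim: s {IHs} => [|z s IHs].
    by under eq_fun do rewrite big_nil; exact: measurable_cst.
  under eq_fun do rewrite big_cons.
  by apply: measurable_funD; [exact: mi|exact: IHs].
apply: step_approximableZ; first exact: measurable_indic.
by apply: step_approximable_indic.
Unshelve. all: by end_near. Qed.

End step_approximation.

(** * Level sets and pairs of cells *)

Section pair_sums.
Context {R : realType} {N n m : nat}.
Local Notation cellT := {ffun 'I_N.+1 -> 'I_n * 'I_m}.
Local Notation pairT := {ffun 'I_N.+1 -> 'I_n * 'I_m * 'I_m}.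
Local Notation offT := {ffun 'I_N.+1 -> 'I_m}.
Implicit Types (K : cellT) (w : pairT) (b : offT).

Definition with_offset K b : cellT := [ffun i => ((K i).1, b i)].

(** A pair is its left cell together with a free choice of interval numbers in the same block, so
    every cell has [m ^ N.+1] partners. *)
Lemma sum_pairs (G : cellT -> cellT -> R) :
  \sum_w G (lcell w) (rcell w) = \sum_K \sum_b G K (with_offset K b).
Proof.
rewrite pair_big/=.
pose f (Kb : cellT * offT) : pairT := [ffun i => (Kb.1 i, Kb.2 i)].
pose g w : cellT * offT := (lcell w, [ffun i => (w i).2]).
rewrite (reindex f); last first.
  exists g => [[K b] _|w _]; last by apply/ffunP => i; rewrite !ffunE; case: (w i).
  by congr pair; apply/ffunP => i; rewrite !ffunE.
apply: eq_bigr => -[K b] _; congr G; apply/ffunP => i; rewrite !ffunE//=.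
Qed.

Lemma sum_pairs_lcell (F : cellT -> R) :
  \sum_w F (lcell w) = (m ^ N.+1)%:R * \sum_K F K.
Proof.
rewrite (sum_pairs (fun K _ => F K)) mulr_sumr; apply: eq_bigr => K _.
by rewrite sumr_const card_ffun !card_ord mulr_natl.
Qed.

(** The involution [f] exchanges the two cells of a pair. *)
Lemma sum_pairs_rcell (F : cellT -> R) :
  \sum_w F (rcell w) = (m ^ N.+1)%:R * \sum_K F K.
Proof.
rewrite -sum_pairs_lcell.
pose f w : pairT := [ffun i => (rgt (w i), (w i).1.2)].
have fK : involutive f by move=> w; apply/ffunP => i; rewrite !ffunE; case: (w i) => -[].
rewrite (reindex_inj (inv_inj fK)); apply: eq_bigr => w _; congr F.
by apply/ffunP => i; rewrite !ffunE /rgt /lft/=; case: (w i) => -[].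
Qed.

End pair_sums.

Section level_sets.
Context {R : realType} {N : nat}.
Variables (x0 : 'rV[R]_N.+1) (r h : R) (n m : nat).
Hypotheses (h0 : 0 < h) (m0 : (0 < m)%N) (hr : h * (n * m)%:R = r).
Local Notation cellT := {ffun 'I_N.+1 -> 'I_n * 'I_m}.
Local Notation T := (lebesgue_space R N.+1).
Local Notation mu := (@lebesgue_rV R N.+1).
Let l : 'rV[R]_N.+1 := x0 - const_mx (r / 2).
Let Q : set T := cube x0 r.
Let mQ : measurable Q. Proof. exact: measurable_cube. Qed.
Implicit Types (K : cellT) (G : set T).
Variables (u : T -> R) (v : cellT -> R).
Hypothesis intu : mu.-integrable Q (EFin \o u).

(** By [partE], the measure of [G] in the cell [K], for [G] measurable in the cube; written as an
    integral, it is compared with [cell_error] by monotonicity. *)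
Definition part G K : R := \int[mu]_(x in Q) \1_(G `&` cell x0 r h K) x.

Definition cell_error K : R :=
  \int[mu]_(x in Q) (`|u x - step_fun x0 r h v x| * \1_(cell x0 r h K) x).

Lemma integrable_indicQ G : measurable G ->
  mu.-integrable Q (EFin \o (\1_G : T -> R)).
Proof.
move=> mG; apply: (@integrable_bounded _ _ _ _ _ 1); first exact: measurable_indic.
by move=> x; rewrite indicE; case: (_ \in _); rewrite ?normr1 ?normr0.
Qed.

Lemma partE G K : measurable G -> G `<=` Q ->
  ((part G K)%:E = mu (G `&` cell x0 r h K))%E.
Proof.
move=> mG GQ; have mGK := measurableI _ _ mG (measurable_cell x0 r h K).
rewrite /part /Rintegral fineK; last exact: (integrable_fin_num mQ (integrable_indicQ mGK)).
rewrite (integral_indic _ mQ mGK); congr lebesgue_rV.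
by apply/setIidPl => x [/GQ].
Qed.

Lemma part_ge0 G K : 0 <= part G K.
Proof. by apply: Rintegral_ge0 => x _; rewrite indicE. Qed.

Lemma part_le G K : measurable G -> G `<=` Q -> part G K <= (2 * h) ^+ N.+1.
Proof.
move=> mG GQ; rewrite -lee_fin (partE K mG GQ).
apply: le_trans (lebesgue_cell_le x0 r h0 K).
by apply: le_outer_measure => x [].
Qed.

Lemma integrable_cell_error K : mu.-integrable Q (EFin \o
  (fun x => `|u x - step_fun x0 r h v x| * \1_(cell x0 r h K) x)).
Proof.
apply: (@integrable_bounded_mul _ T R mu Q mQ (fun x => `|u x - step_fun x0 r h v x|) _ 1).
- exact: integrable_error.
- exact/measurable_indic/measurable_cell.
- by move=> x; rewrite indicE; case: (_ \in _); rewrite ?normr1 ?normr0.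
Qed.

Lemma cell_error_ge0 K : 0 <= cell_error K.
Proof. by apply: Rintegral_ge0 => x _; rewrite mulr_ge0// indicE. Qed.

Lemma sum_cell_error : \sum_K cell_error K <= step_error x0 r h u v.
Proof.
rewrite /cell_error -Rintegral_sum//; last by move=> K; exact: integrable_cell_error.
apply: le_Rintegral; first exact: mQ.
- by apply: integrable_finite_sum => // K; exact: integrable_cell_error.
- exact: integrable_error.
move=> x Qx; rewrite -mulr_sumr ler_piMr//.
have [K xK] := cell_exists h0 m0 hr Qx.
rewrite (bigD1 K)//= big1 ?addr0; first by rewrite indicE mem_set.
move=> K' K'K; rewrite indicE memNset// => xK'.
by move/eqP: K'K; apply; exact: cell_inj xK' xK.
Qed.

Lemma part_level G K (s t : R) : measurable G ->
  (forall x, G x -> cell x0 r h K x -> s <= `|u x - step_fun x0 r h v x| + t) ->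
  s * part G K <= cell_error K + t * part G K.
Proof.
move=> mG Gst; have mGK := measurableI _ _ mG (measurable_cell x0 r h K).
have iG := integrable_indicQ mGK.
rewrite /part -!RintegralZl// /cell_error -RintegralD//; first last.
- exact: integrable_scale.
- exact: integrable_cell_error.
apply: le_Rintegral; first exact: mQ.
- exact: integrable_scale.
- have := @integrableD _ _ _ mu Q mQ _ _ (integrable_cell_error K) (integrable_scale mQ t iG).
  exact.
move=> x _; rewrite !indicE in_setI.
have [xK|_] := boolP (x \in cell x0 r h K); last by rewrite andbF !mulr0 addr0.
have [xG|_] := boolP (x \in G); last by rewrite !mulr0 addr0 mulr_ge0.
by rewrite !mulr1; apply: Gst; exact: set_mem.
Qed.

(** Averaged over the cells, [a] is at most [v K] plus an error on [E], and [v K'] is at most [b]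
    plus an error on [F]. Weighting each inequality by the measure of the other set and adding
    leaves [a - b] against [v K - v K']; this is the discrete form of the double integral. *)
Lemma pair_level (E F : set T) (a b : R) K K' :
  measurable E -> E `<=` Q -> measurable F -> F `<=` Q ->
  (forall x, E x -> a < u x) -> (forall x, F x -> u x <= b) ->
  part E K * part F K' * (a - b) <=
    ((2 * h) ^+ N.+1) ^+ 2 * `|v K - v K'| +
    (2 * h) ^+ N.+1 * (cell_error K + cell_error K').
Proof.
move=> mE EQ mF FQ Ea Fb.
have lE : a * part E K <= cell_error K + v K * part E K.
  apply: part_level => // x Ex xK; rewrite (step_funE h0 m0 v xK).
  by have := ler_norm (u x - v K); have := Ea _ Ex; lra.
have lF : v K' * part F K' <= cell_error K' + b * part F K'.
  apply: part_level => // x Fx xK; rewrite (step_funE h0 m0 v xK) distrC.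
  by have := ler_norm (v K' - u x); have := Fb _ Fx; lra.
set w := (2 * h) ^+ N.+1.
have w0 : 0 <= w by rewrite exprn_ge0// mulr_ge0// ltW.
have e0 := part_ge0 E K; have f0 := part_ge0 F K'.
have ew := part_le K mE EQ; have fw := part_le K' mF FQ.
have d0 := cell_error_ge0 K; have d0' := cell_error_ge0 K'.
set e := part E K in lE e0 ew *; set f := part F K' in lF f0 fw *.
have h1 : f * (a * e) <= f * (cell_error K + v K * e) by rewrite ler_wpM2l.
have h2 : e * (v K' * f) <= e * (cell_error K' + b * f) by rewrite ler_wpM2l.
have h3 : f * cell_error K <= w * cell_error K by rewrite ler_wpM2r.
have h4 : e * cell_error K' <= w * cell_error K' by rewrite ler_wpM2r.
have h5 : e * f * (v K - v K') <= w ^+ 2 * `|v K - v K'|.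
  apply: le_trans (_ : e * f * `|v K - v K'| <= _).
    by rewrite ler_wpM2l ?mulr_ge0// ler_norm.
  by rewrite ler_wpM2r// expr2 ler_pM.
clear -h1 h2 h3 h4 h5; clearbody w e f; lra.
Qed.

Let hrE : r = h * m%:R * n%:R. Proof. by rewrite -hr natrM; ring. Qed.

Definition block_center K : 'rV[R]_N.+1 :=
  \row_i (l 0 i + h * m%:R * (((K i).1)%:R + 2^-1)).

Lemma block_center_cube K : cube x0 r (block_center K).
Proof.
apply/cubeP => i; rewrite !mxE.
have hm0 : 0 < h * m%:R by rewrite mulr_gt0// ltr0n.
have k0 : 0 <= h * m%:R * ((K i).1)%:R by rewrite mulr_ge0// ltW.
have k1 : h * m%:R * (((K i).1)%:R + 1) <= r.
  by rewrite [leRHS]hrE ler_pM2l// natr1 ler_nat.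
move: k1; rewrite !mulrDr mulr1; lra.
Qed.

(** Each interval of the grid lies in a single block, so a cell that meets the open block carries
    its block number in every coordinate. *)
Lemma block_cells K x : cube (block_center K) (h * m%:R) x -> cube x0 r x ->
  exists b, cell x0 r h (with_offset K b) x.
Proof.
move=> xB xQ; have [K' xK'] := cell_exists h0 m0 hr xQ.
exists [ffun i => (K' i).2].
suff -> : with_offset K [ffun i => (K' i).2] = K' by [].
apply/ffunP => i; rewrite !ffunE [RHS]surjective_pairing; congr pair.
have hm0 : 0 < h * m%:R by rewrite mulr_gt0// ltr0n.
have := xB i; rewrite !mxE => /andP[b1 b2]; have /andP[c1 c2] := xK' i.
have p1 : h * m%:R * ((K' i).1)%:R <= h * (pos (K' i))%:R.
  by rewrite -mulrA ler_pM2l// -natrM ler_nat mulnC leq_addr.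
have p2 : h * ((pos (K' i))%:R + 1) <= h * m%:R * (((K' i).1)%:R + 1).
  rewrite -mulrA ler_pM2l// !natr1 -natrM ler_nat mulnC mulSn addnC /pos -addnS.
  by rewrite leq_add2l.
move: b1 b2 c1 c2; rewrite -/(l 0 i) /l !mxE => b1 b2 c1 c2.
have lt1 (j j' : nat) : h * m%:R * j%:R < h * m%:R * (j'%:R + 1) -> (j <= j')%N.
  by rewrite ltr_pM2l// natr1 ltr_nat ltnS.
apply/val_inj/eqP; rewrite eqn_leq !lt1//.
- move: p1 p2; rewrite !mulrDr !mulr1; rewrite !mulrDr !mulr1 in b1 b2 c1 c2; lra.
- move: p1 p2; rewrite !mulrDr !mulr1; rewrite !mulrDr !mulr1 in b1 b2 c1 c2; lra.
Qed.

Lemma sum_part G : measurable G -> G `<=` Q ->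
  (mu G <= (\sum_K part G K)%:E)%E.
Proof.
move=> mG GQ; rewrite -sumEFin (eq_bigr (fun K => mu (G `&` cell x0 r h K))); last first.
  by move=> K _; exact: partE.
apply: lebesgue_finite_cover => x Gx.
by have [K xK] := cell_exists h0 m0 hr (GQ _ Gx); exists K.
Qed.

(** By subadditivity, the measure of the block is shared between its points above [b], bounded by
    hypothesis, and the traces of [F] on its cells, which must supply the rest. *)
Lemma sum_part_block (F : set T) (d b : R) K : measurable F -> F `<=` Q ->
  (forall x, Q x -> u x <= b -> F x) ->
  (mu (cube (block_center K) (h * m%:R) `&` Q `&` [set x | (b < u x)%R]) <=
    ((1 - d) * (h * m%:R) ^+ N.+1)%:E)%E ->
  d * (h * m%:R) ^+ N.+1 <= \sum_c part F (with_offset K c).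
Proof.
move=> mF FQ bF; set s := h * m%:R; set B := cube _ s.
have s0 : 0 < s by rewrite mulr_gt0// ltr0n.
set P := _ `&` [set x | _] => PB.
have BQ x : B x -> cube x0 r x.
  move=> xB; apply/cubeP => i; rewrite -/l.
  have := xB i; rewrite !mxE => xBi.
  have k0 : 0 <= s * ((K i).1)%:R by rewrite mulr_ge0// ltW.
  have k1 : s * (((K i).1)%:R + 1) <= r.
    by rewrite [leRHS]hrE ler_pM2l// natr1 ler_nat.
  by move: k1 xBi; rewrite -/s !mulrDr mulr1; lra.
have sB : ((s ^+ N.+1)%:E <= mu B)%E.
  apply: le_trans (box_volume_le_lebesgue _ _); rewrite lee_fin box_volume_incl.
    rewrite -[in leLHS](card_ord N.+1) -prodr_const.
    by rewrite le_eqVlt; apply/orP; left; apply/eqP; apply: eq_bigr => i _;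
      rewrite !mxE; field.
  by move=> i; rewrite !mxE; lra.
have : (mu B <= mu P + \sum_c mu (F `&` cell x0 r h (with_offset K c)))%E.
  apply: (@le_trans _ _ (mu P + mu (F `&` B))%E).
    apply: le_trans (outer_measureU2 (@lebesgue_outer R N.+1) _ _).
    apply: le_outer_measure => x xB; have xQ := BQ _ xB.
    have [ux|ux] := leP (u x) b; [right; split=> //; exact: bF|by left; split].
  apply: leeD => //; apply: lebesgue_finite_cover => x [Fx Bx].
  by have [c xc] := block_cells Bx (BQ _ Bx); exists c.
rewrite (eq_bigr (fun c => (part F (with_offset K c))%:E)); last first.
  by move=> c _; rewrite partE.
rewrite sumEFin => /(le_trans sB)/le_trans/(_ (leeD PB (le_refl _))).
by rewrite -EFinD lee_fin; lra.
Qed.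

End level_sets.

(** * Comparing the two bounds for the sum over pairs *)

Section clustering.
Context {R : realType} {N : nat}.
Variables (x0 : 'rV[R]_N.+1) (r h : R) (n m : nat).
Hypotheses (h0 : 0 < h) (n0 : (0 < n)%N) (m0 : (0 < m)%N) (hr : h * (n * m)%:R = r).
Local Notation cellT := {ffun 'I_N.+1 -> 'I_n * 'I_m}.
Local Notation pairT := {ffun 'I_N.+1 -> 'I_n * 'I_m * 'I_m}.
Local Notation T := (lebesgue_space R N.+1).
Local Notation mu := (@lebesgue_rV R N.+1).
Let Q : set T := cube x0 r.

(** In each coordinate, (2h)^2 = (8 / [bump_min]) * h * ([bump_min] * h / 2): the last factor is the
    lower bound for the contribution to [cell_weight]. *)
Definition cluster_const : R := (8 / bump_min) ^+ N.+1.

Lemma cluster_const_gt0 : 0 < cluster_const.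
Proof. by rewrite exprn_gt0// divr_gt0// bump_min_gt0. Qed.

Lemma cell_volume_sq_le : ((2 * h) ^+ N.+1) ^+ 2 <=
  cluster_const * h ^+ N.+1 * cell_weight x0 r h.
Proof.
have := cell_weight_ge x0 h0 m0 hr n0.
have c0 : 0 <= cluster_const * h ^+ N.+1.
  apply: mulr_ge0; first exact/ltW/cluster_const_gt0.
  by rewrite exprn_ge0// ltW.
move=> /(ler_wpM2l c0); apply: le_trans.
rewrite expr2 -!exprMn le_eqVlt; apply/orP; left; apply/eqP; congr (_ ^+ _).
by field; rewrite gt_eqF// bump_min_gt0.
Qed.

(** The values [v K], times the weight, are replaced by the bump integrals of [u]. Each cell occurs
    in [m ^ N.+1] pairs on either side, whence the factor of the error. *)
Lemma sum_step_diff (u : T -> R) (v : cellT -> R) (V : R) :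
  mu.-integrable Q (EFin \o u) -> (BV_seminorm (Q : set 'rV[R]_N.+1) u <= V%:E)%E ->
  cell_weight x0 r h * \sum_w `|v (lcell w) - v (rcell w)| <=
    @field_bound R N m * h * V + 2 * (m ^ N.+1)%:R * step_error x0 r h u v.
Proof.
move=> intu BVu; set be := cell_weight _ _ _.
have be0 : 0 <= be.
  by apply: fine_ge0; apply: integral_ge0 => x _; rewrite lee_fin base_bump_ge0.
pose err K : R := `|cell_mass x0 r h u K - v K * be|.
have errS : \sum_K err K <= step_error x0 r h u v.
  exact: sum_cell_mass_error.
apply: (@le_trans _ _ (\sum_w (`|cell_mass x0 r h u (lcell w) -
    cell_mass x0 r h u (rcell w)| + (err (lcell w) + err (rcell w))))).
  rewrite mulr_sumr; apply: ler_sum => w _.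
  rewrite -{1}(ger0_norm be0) -normrM mulrBr !(mulrC be) /err.
  set a := cell_mass _ _ _ _ _; set b := cell_mass _ _ _ _ _.
  have -> : v (lcell w) * be - v (rcell w) * be =
    (a - b) - (a - v (lcell w) * be) + (b - v (rcell w) * be) by ring.
  by rewrite [leRHS]addrA; apply: le_trans (ler_normD _ _) _;
    apply: lerD => //; exact: ler_normB.
rewrite big_split/=; apply: lerD; first exact: sum_cell_mass_diff.
rewrite big_split/= sum_pairs_lcell sum_pairs_rcell.
rewrite (_ : _ + _ = 2 * (m ^ N.+1)%:R * \sum_K err K); last by ring.
by rewrite ler_wpM2l// mulr_ge0.
Qed.

Lemma level_gap_bound (u : T -> R) (v : cellT -> R) (V a b alpha delta e : R) :
  mu.-integrable Q (EFin \o u) -> (BV_seminorm (Q : set 'rV[R]_N.+1) u <= V%:E)%E ->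
  b <= a -> 0 <= delta ->
  ((alpha * r ^+ N.+1)%:E <= mu (Q `&` [set x | (a < u x)%R]))%E ->
  (forall x1, cube x0 r x1 ->
    (mu (cube x1 (h * m%:R) `&` Q `&` [set x | (b < u x)%R]) <=
    ((1 - delta) * (h * m%:R) ^+ N.+1)%:E)%E) ->
  step_error x0 r h u v <= e ->
  alpha * r ^+ N.+1 * delta * (a - b) <=
    cluster_const * N.+1%:R * (h * m%:R) * V +
    (2 * cluster_const + 2 * 2 ^+ N.+1) * e.
Proof.
move=> intu BVu ba d0 muE badF err_e.
have mu_u : measurable_fun Q u by have /integrableP[/measurable_EFinP] := intu.
have mQ : measurable Q by exact: measurable_cube.
pose E : set T := Q `&` [set x | a < u x].
pose F : set T := Q `&` [set x | u x <= b].
have mE : measurable E.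
  rewrite (_ : E = Q `&` u @^-1` `]a, +oo[%classic); first exact: mu_u.
  by apply/seteqP; split=> x [Qx ux]; split=> //; move: ux; rewrite /= in_itv/= andbT.
have mF : measurable F.
  rewrite (_ : F = Q `&` u @^-1` `]-oo, b]%classic); first exact: mu_u.
  by apply/seteqP; split=> x [Qx ux]; split=> //; move: ux; rewrite /= in_itv.
have EQ : E `<=` Q by move=> x [].
have FQ : F `<=` Q by move=> x [].
set s := h * m%:R; have s0 : 0 < s by rewrite mulr_gt0// ltr0n.
set d := N.+1; set w := (2 * h) ^+ d; set A := cluster_const.
have A0 : 0 < A by exact: cluster_const_gt0.
have w0 : 0 <= w by rewrite exprn_ge0// mulr_ge0// ltW.
have sumE : alpha * r ^+ d <= \sum_(K : cellT) part x0 r h E K.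
  by rewrite -lee_fin; apply: le_trans muE _; exact: sum_part.
(* Summing over the right cells first gives the density of [F] in the block; summing over the left
   cells then gives the measure of [E]. *)
have lower : alpha * r ^+ d * (delta * s ^+ d) * (a - b) <=
    \sum_(p : pairT) part x0 r h E (lcell p) * part x0 r h F (rcell p) * (a - b).
  rewrite -mulr_suml ler_wpM2r ?subr_ge0//.
  rewrite (sum_pairs (fun K K' => part x0 r h E K * part x0 r h F K')).
  have ds0 : 0 <= delta * s ^+ d by rewrite mulr_ge0// exprn_ge0// ltW.
  apply: le_trans (ler_wpM2r ds0 sumE) _; rewrite mulr_suml.
  apply: ler_sum => K _; rewrite -mulr_sumr ler_wpM2l ?part_ge0//.
  have bF x : Q x -> u x <= b -> F x by move=> Qx ux; split.
  apply: (@sum_part_block _ _ _ _ _ _ _ h0 m0 hr u F delta b K mF FQ bF).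
  by apply: badF; exact: block_center_cube.
pose X := \sum_(p : pairT)
  `|v (lcell p) - v (rcell p)|.
have X0 : 0 <= X by apply: sumr_ge0.
pose D := \sum_K cell_error x0 r h u v K.
have De : D <= e by apply: le_trans err_e; exact: sum_cell_error.
have upper : \sum_(p : pairT) part x0 r h E (lcell p) * part x0 r h F (rcell p) * (a - b) <=
    w ^+ 2 * X + 2 * w * (m ^ d)%:R * e.
  apply: (@le_trans _ _ (\sum_(p : pairT) (w ^+ 2 * `|v (lcell p) - v (rcell p)| +
      w * (cell_error x0 r h u v (lcell p) + cell_error x0 r h u v (rcell p))))).
    apply: ler_sum => p _; apply: pair_level => //.
    - by move=> x [].
    - by move=> x [].
  rewrite big_split/= -!mulr_sumr lerD2l big_split/= sum_pairs_lcell sum_pairs_rcell.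
  rewrite -/D -/d (_ : w * _ = 2 * w * (m ^ d)%:R * D); last by ring.
  by rewrite ler_wpM2l// !mulr_ge0.
have bX := sum_step_diff v intu BVu; rewrite -/X in bX.
pose Y := @field_bound R N m * h * V + 2 * (m ^ d)%:R * e.
have bY : cell_weight x0 r h * X <= Y.
  by apply: le_trans bX _; rewrite lerD2l ler_wpM2l// mulr_ge0.
have wX : w ^+ 2 * X <= A * h ^+ d * Y.
  apply: le_trans (ler_wpM2r X0 cell_volume_sq_le) _.
  have Ah0 : 0 <= A * h ^+ d.
    by apply: mulr_ge0; [exact: ltW|rewrite exprn_ge0// ltW].
  by have := ler_wpM2l Ah0 bY; rewrite !mulrA.
have sd0 : 0 < s ^+ d by rewrite exprn_gt0.
rewrite -(ler_pM2r sd0).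
have -> : alpha * r ^+ d * delta * (a - b) * s ^+ d =
  alpha * r ^+ d * (delta * s ^+ d) * (a - b) by ring.
apply: le_trans lower _; apply: le_trans upper _.
apply: le_trans (lerD wX (lexx _)) _.
(* Power count: the term with [V] carries [h ^ d * h * m ^ d.+1], that is [s ^ d.+1], and both error
   terms carry [(h * m) ^ d]. After division by [s ^ d] only [s] remains of the mesh. *)
rewrite le_eqVlt; apply/orP; left; apply/eqP.
rewrite /Y /field_bound natrX /w /s !exprMn -/d exprS -/d; ring.
Qed.

End clustering.

(** * Choice of the block side and of the grid *)

Theorem corollary3p2 (R : realType) (N : nat) (hN : (2 <= N)%N)
    (x0 : 'rV[R]_N) (r c alpha gamma'' delta lambda : R)
    (hr : 0 < r) (hc : 0 < c) (halpha : 0 < alpha < 1) (hgamma : 0 < gamma'')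
    (hdelta : 0 < delta < 1) (hlambda : 0 < lambda < 1) :
  exists eta : R, 0 < eta < 1 /\
    forall u : 'rV[R]_N -> R,
      BV (cube x0 r) u ->
      ((alpha * r ^+ N)%:E
         < lebesgue_rV N (cube x0 r `&` [set x | (c < u x)%R]))%E ->
      (BV_seminorm (cube x0 r) u <= (gamma'' * c * r ^+ N.-1)%:E)%E ->
      exists2 x1 : 'rV[R]_N, cube x0 r x1 &
        (((1 - delta) * (eta * r) ^+ N)%:E
           < lebesgue_rV N
               (cube x1 (eta * r) `&` cube x0 r
                  `&` [set x | (lambda * c < u x)%R]))%E.
Proof.
case: N hN x0 => // N _ x0.
have /andP[alpha0 _] := halpha; have /andP[delta0 _] := hdelta.
have /andP[lambda0 lambda1] := hlambda.
pose A : R := @cluster_const R N; have A0 : 0 < A by exact: cluster_const_gt0.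
have lam1 : 0 < 1 - lambda by rewrite subr_gt0.
have B0 : 0 < alpha * delta * (1 - lambda) by rewrite !mulr_gt0.
(* For blocks of side [r / n], the lower bound of [level_gap_bound] exceeds the term with the
   seminorm exactly when [n] exceeds [q]. *)
pose q := A * N.+1%:R * gamma'' / (alpha * delta * (1 - lambda)).
(* One successor exceeds [q]; the second ensures [n >= 2], hence [eta < 1]. *)
pose n := (Num.truncn q).+2.
have n0 : (0 < n)%N by [].
have nR0 : 0 < n%:R :> R by rewrite ltr0n.
have qn : q < n%:R.
  by apply: lt_le_trans (truncnS_gt _) _; rewrite ler_nat.
exists n%:R^-1; split.
  by rewrite invr_gt0 nR0/= invf_lt1// ltr1n.
move=> u [intu _] muE BVu; apply: contrapT => noball.
pose s := n%:R^-1 * r.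
pose De := alpha * r ^+ N.+1 * delta * (c - lambda * c) -
  A * N.+1%:R * s * (gamma'' * c * r ^+ N).
have De0 : 0 < De.
  rewrite /De /s.
  have -> : alpha * r ^+ N.+1 * delta * (c - lambda * c) -
      A * N.+1%:R * (n%:R^-1 * r) * (gamma'' * c * r ^+ N) =
    r ^+ N.+1 * c * (alpha * delta * (1 - lambda) - A * N.+1%:R * gamma'' / n%:R).
    by rewrite exprS; ring.
  rewrite !mulr_gt0 ?exprn_gt0// subr_gt0 ltr_pdivrMr//.
  by move: qn; rewrite /q ltr_pdivrMr// [n%:R * _]mulrC.
pose C : R := 2 * A + 2 * 2 ^+ N.+1.
have C0 : 0 < C by rewrite addr_gt0// mulr_gt0// exprn_gt0.
(* With this error [level_gap_bound] would give [De <= De / 2], against [De0]. *)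
pose e := De / (2 * C).
have e0 : 0 < e by rewrite divr_gt0// mulr_gt0.
(* The grid and its values depend on [u], with [n] already fixed. [m1.+1] is both beyond the
   threshold and positive. *)
have [m1 /(_ m1.+1 (leqnSn _) isT)[v ve]] := step_approximable_integrable hr n0 intu e0.
pose m := m1.+1; pose h : R := mesh r n m.
have h0 : 0 < h by exact: mesh_gt0.
have hrE : h * (n * m)%:R = r by exact: meshE.
have hmE : h * m%:R = s.
  by rewrite /h /mesh /s natrM; field; rewrite !pnatr_eq0.
have err : step_error x0 r h u v <= e.
  rewrite -lee_fin /step_error /Rintegral fineK//.
  apply: integrable_fin_num; first exact: measurable_cube.
  exact: integrable_error.
have := @level_gap_bound R N x0 r h n m h0 n0 isT hrE u v
  (gamma'' * c * r ^+ N) c (lambda * c) alpha delta e intu BVu.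
have lcc : lambda * c <= c by rewrite ler_piMl// ltW.
have badF x1 : cube x0 r x1 -> (lebesgue_rV N.+1
    (cube x1 (h * m%:R) `&` cube x0 r `&` [set x | (lambda * c < u x)%R]) <=
    ((1 - delta) * (h * m%:R) ^+ N.+1)%:E)%E.
  move=> x1Q; rewrite leNgt; apply/negP; rewrite hmE => big.
  by apply: noball; exists x1.
move=> /(_ lcc (ltW delta0) (ltW muE) badF err).
rewrite hmE -/A -/C => bound.
have Ce : C * e = De / 2 by rewrite /e; field; rewrite gt_eqF.
move: bound; rewrite Ce; move: De0; rewrite /De; lra.
Qed.
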